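(* Let $\Omega=\{0,1,2\}^{\mathbb{N}}$ be the set of all infinite sequences over $\{0,1,2\}$ with the product (Tychonoff) topology, let $\mathcal{M}_2$ be the space of marked $2$-generated groups, and let $L=\mathbb{Z}_2\wr\mathbb{Z}$ be the Lamplighter group. There exists a subset $$\mathcal{L}=\{(L_\omega,T_\omega)\mid \omega\in\Omega\}\subset\mathcal{M}_2$$ (a family of marked groups indexed by $\Omega$) with the following properties: (a) $\mathcal{L}$ is homeomorphic to $\Omega$ (and hence is a Cantor set); (b) if $\omega\in\Omega$ is not eventually constant, then $L_\omega$ has intermediate growth; (c) if $\omega\in\Omega$ is a constant sequence, then $L_\omega\cong L$; (d) all groups in $\mathcal{L}$ are condensation groups.
   Context: For $k\ge 1$, $\mathcal{M}_k$ is the space of marked $k$-generated groups: its points are pairs $(G,S)$ where $G$ is a group and $S=(s_1,\dots,s_k)$ is an ordered tuple of (not necessarily distinct) elements generating $G$; $(G,S)$ and $(H,T)$ are identified when $s_i\mapsto t_i$ ($i=1,\dots,k$) extends to an isomorphism $G\to H$. Two points are at distance $\le 2^{-N}$ if the balls of radius $N$ around the identity in the (labelled) Cayley graphs of $(G,S)$ and $(H,T)$ are isomorphic. With this ultrametric $\mathcal{M}_k$ is compact, totally disconnected and separable; a sequence $(G_n,S_n)$ converges to $(G,S)$ if and only if for every $w$ in the free group $F_k$ there is $N_w$ such that for all $n\ge N_w$: $w=1$ holds in $G$ if and only if $w=1$ holds in $G_n$. The perfect kernel (condensation part) $\kappa(X)$ of a Polish space $X$ is the set of points all of whose open neighborhoods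 are uncountable (equivalently, the stable term of the transfinite Cantor–Bendixson derivative sequence). A finitely generated group $G$ is a condensation group if for some generating tuple $S$ of some size $k$ the point $(G,S)$ belongs to $\kappa(\mathcal{M}_k)$ (this does not depend on the choice of $S$). A finitely generated group has intermediate growth if its word-growth function is neither bounded above by a polynomial nor bounded below by an exponential function $c^n$ with $c>1$. $\mathbb{Z}_2\wr\mathbb{Z}$ is the restricted wreath product $\left(\bigoplus_{\mathbb{Z}}\mathbb{Z}_2\right)\rtimes\mathbb{Z}$ with $\mathbb{Z}$ acting by shifting coordinates; $\mathbb{Z}_2=\mathbb{Z}/2\mathbb{Z}$. A sequence is eventually constant if it is constant from some index on. *)

(* Defs.v *)
From HB Require Import structures.
From mathcomp Require Import all_boot all_order all_algebra.
From mathcomp Require Import finmap generic_quotient.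
From mathcomp Require Import boolp classical_sets functions cardinality reals.
From mathcomp Require Import topology cantor.

Set Implicit Arguments.
Unset Strict Implicit.
Unset Printing Implicit Defensive.

Import Order.TTheory GRing.Theory Num.Theory.

Local Open Scope classical_set_scope.
Local Open Scope group_scope.
Local Open Scope quotient_scope.

(* A letter (b, i) stands for s_i if b = false and for s_i^-1 if b = true.    *)
Definition word (k : nat) : Type := seq (bool * 'I_k).

Definition letter_eval (G : groupType) (k : nat) (S : k.-tuple G)
    (x : bool * 'I_k) : G :=
  if x.1 then (tnth S x.2)^-1 else tnth S x.2.

Definition word_eval (G : groupType) (k : nat) (S : k.-tuple G)
    (w : word k) : G :=
  \prod_(x <- w) letter_eval S x.

Definition generates (G : groupType) (k : nat) (S : k.-tuple G) : Prop :=
  forall g : G, exists w : word k, word_eval S w = g.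

Definition group_isomorphic (G H : groupType) : Prop :=
  exists f : {multiplicative G -> H}, bijective f.

(* A quotient of the type of all (groupType, generators) pairs cannot be a    *)
(* choiceType, as it lives one universe above the carriers of groupType and   *)
(* choiceType.  The carriers of marked groups are therefore taken in an       *)
(* arbitrary smaller universe; no isomorphism type is lost, a finitely        *)
(* generated group being countable.                                           *)
Record small_group := SmallGroup {
  sg_sort : Type;
  sg_class : Group.axioms_ sg_sort
}.

Definition small_group_groupType (G : small_group) : groupType :=
  Group.Pack (sg_class G).
Coercion small_group_groupType : small_group >-> Group.type.

Record marked_group (k : nat) := MarkedGroup {
  mg_group :> small_group;
  mg_gens : k.-tuple (mg_group : groupType);
  mg_generates : generates mg_gens
}.

HB.instance Definition _ (k : nat) := gen_eqMixin (marked_group k).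
HB.instance Definition _ (k : nat) := gen_choiceMixin (marked_group k).

Definition marked_iso (k : nat) (X Y : marked_group k) : Prop :=
  exists f : {multiplicative X -> Y},
    bijective f /\
    forall i : 'I_k, f (tnth (mg_gens X) i) = tnth (mg_gens Y) i.

(* Vertex set of the ball of radius n around 1 in the Cayley graph. *)
Definition cayley_ball (G : groupType) (k : nat) (S : k.-tuple G) (n : nat)
    : set G :=
  [set g | exists2 w : word k, (size w <= n)%N & word_eval S w = g].

(* Isomorphism of rooted graphs with oriented labelled edges: the Cayley      *)
(* graph has an edge labelled i from g to g * s_i, and a ball is the subgraph *)
(* induced on its vertices.                                                   *)
Definition cayley_ball_iso (k n : nat) (X Y : marked_group k) : Prop :=
  exists f : X -> Y,
    [/\ set_bij (cayley_ball (mg_gens X) n) (cayley_ball (mg_gens Y) n) f,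
        f 1 = 1 &
        forall (g h : X) (i : 'I_k),
          cayley_ball (mg_gens X) n g -> cayley_ball (mg_gens X) n h ->
          (g * tnth (mg_gens X) i = h <-> f g * tnth (mg_gens Y) i = f h)].

Section MarkedIsoTheory.
Variable k : nat.
Implicit Types X Y Z : marked_group k.

Lemma marked_iso_refl X : marked_iso X X.
Proof. by exists (idfun : {multiplicative X -> X}); split=> //; exists id. Qed.

Lemma marked_iso_sym X Y : marked_iso X Y -> marked_iso Y X.
Proof.
move=> [f [[g fg gf] fS]].
have gM : {morph g : x y / x * y}.
  by move=> x y; rewrite -{1}(gf x) -{1}(gf y) -gmulfM fg.
pose gm : {multiplicative Y -> X} :=
  HB.pack g (isMultiplicative.Build Y X g gM).
exists gm; split; first by exists f.
by move=> i; rewrite -fS /= fg.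
Qed.

Lemma marked_iso_trans X Y Z :
  marked_iso X Y -> marked_iso Y Z -> marked_iso X Z.
Proof.
move=> [f [bf fS]] [g [bg gS]].
exists (g \o f : {multiplicative X -> Z}); split; first exact: bij_comp.
by move=> i /=; rewrite fS gS.
Qed.

Lemma cayley_ball1 (G : groupType) (S : k.-tuple G) n : cayley_ball S n 1.
Proof. by exists [::] => //; rewrite /word_eval big_nil. Qed.

Lemma cayley_ballS (G : groupType) (S : k.-tuple G) m n :
  (m <= n)%N -> cayley_ball S m `<=` cayley_ball S n.
Proof. by move=> mn g [w wm <-]; exists w => //; exact: leq_trans mn. Qed.

Lemma word_eval_rcons (G : groupType) (S : k.-tuple G) w x :
  word_eval S (rcons w x) = word_eval S w * letter_eval S x.
Proof. by rewrite /word_eval -cats1 big_cat big_seq1. Qed.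

Lemma cayley_ball_isoP n X Y (f : X -> Y) :
  f 1 = 1 ->
  (forall (g h : X) (i : 'I_k),
     cayley_ball (mg_gens X) n g -> cayley_ball (mg_gens X) n h ->
     (g * tnth (mg_gens X) i = h <-> f g * tnth (mg_gens Y) i = f h)) ->
  forall w : word k, (size w <= n)%N ->
    f (word_eval (mg_gens X) w) = word_eval (mg_gens Y) w.
Proof.
move=> f1 fE; elim/last_ind => [|w [b i] IH] wn.
  by rewrite /word_eval !big_nil.
have wn' : (size w <= n)%N by move: wn; rewrite size_rcons; exact: ltnW.
have Bw : cayley_ball (mg_gens X) n (word_eval (mg_gens X) w) by exists w.
have Bwx : cayley_ball (mg_gens X) n
    (word_eval (mg_gens X) (rcons w (b, i))) by exists (rcons w (b, i)).
rewrite [in RHS]word_eval_rcons -(IH wn').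
move: Bwx; rewrite word_eval_rcons /letter_eval /=.
case: b {wn} => Bwx.
  have /(fE _ _ i Bwx Bw) <- :
      word_eval (mg_gens X) w * (tnth (mg_gens X) i)^-1
        * tnth (mg_gens X) i = word_eval (mg_gens X) w.
    by rewrite mulgVK.
  by rewrite mulgK.
by have /(fE _ _ i Bw Bwx) <- :
  word_eval (mg_gens X) w * tnth (mg_gens X) i =
  word_eval (mg_gens X) w * tnth (mg_gens X) i by [].
Qed.

Lemma cayley_ball_iso_leq m n X Y : (m <= n)%N ->
  cayley_ball_iso n X Y -> cayley_ball_iso m X Y.
Proof.
move=> mn [f [[fB fI fS] f1 fE]]; exists f.
have fw := cayley_ball_isoP f1 fE.
split=> //; last first.
  by move=> g h i /(cayley_ballS mn) Bg /(cayley_ballS mn) Bh; exact: fE.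
split.
- move=> g [w wm <-]; rewrite fw ?(leq_trans wm)//.
  by exists w.
- move=> g h; rewrite !inE => /(cayley_ballS mn) Bg /(cayley_ballS mn) Bh.
  by apply: fI; rewrite inE.
- move=> h [w wm <-]; exists (word_eval (mg_gens X) w); first by exists w.
  by rewrite fw ?(leq_trans wm).
Qed.

Lemma cayley_ball_iso_refl n X : cayley_ball_iso n X X.
Proof. by exists id; split=> //; split=> // x Bx; exists x. Qed.

Lemma cayley_ball_iso_trans n X Y Z :
  cayley_ball_iso n X Y -> cayley_ball_iso n Y Z -> cayley_ball_iso n X Z.
Proof.
move=> [f [bf f1 fE]] [g [bg g1 gE]]; exists (g \o f); split.
- exact: set_bij_comp bf bg.
- by rewrite /= f1.
- case: bf => fB _ _ x y i Bx By.
  by rewrite (fE x y i Bx By) /=; apply: gE; exact: fB.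
Qed.

Lemma marked_iso_ball n X Y : marked_iso X Y -> cayley_ball_iso n X Y.
Proof.
move=> [f [bf fS]].
have fw w : f (word_eval (mg_gens X) w) = word_eval (mg_gens Y) w.
  have f1 : f 1 = 1 by apply: (mulgI (f 1)); rewrite -gmulfM !mulg1.
  elim/last_ind: w => [|w [b i] IH]; first by rewrite /word_eval !big_nil.
  have fV : f (tnth (mg_gens X) i)^-1 = (tnth (mg_gens Y) i)^-1.
    by apply: (mulIg (tnth (mg_gens Y) i)); rewrite -{1}fS -gmulfM !mulVg.
  by rewrite !word_eval_rcons gmulfM IH /letter_eval /=; case: b; rewrite ?fS ?fV.
exists f; split.
- split.
  + by move=> g [w wn <-]; exists w.
  + by move=> g h _ _; exact: (bij_inj bf).
  + by move=> h [w wn <-]; exists (word_eval (mg_gens X) w) => //; exists w.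
- by have := fw [::]; rewrite /word_eval !big_nil.
- move=> g h i _ _; rewrite -fS -gmulfM; split=> [->//|].
  exact: (bij_inj bf).
Qed.

Lemma finite_cayley_ball (G : groupType) (S : k.-tuple G) n :
  finite_set (cayley_ball S n).
Proof.
elim: n => [|n IH].
  apply: (@sub_finite_set _ _ [set 1]); last exact: finite_set1.
  move=> g [[|//] _ <-]; by rewrite /word_eval big_nil.
pose f (p : G * option (bool * 'I_k)) :=
  if p.2 is Some x then p.1 * letter_eval S x else p.1.
apply: (@sub_finite_set _ _ (f @` (cayley_ball S n `*` setT))).
  move=> g [w]; case/lastP: w => [|w x] wn <-.
    by exists (1, None); rewrite /word_eval ?big_nil//; split=> //; exact: cayley_ball1.
  exists (word_eval S w, Some x); last by rewrite word_eval_rcons.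
  by split=> //; exists w => //; move: wn; rewrite size_rcons.
by apply: finite_image; apply: finite_setX => //; exact: finite_finset.
Qed.

End MarkedIsoTheory.

Definition marked_isob (k : nat) : rel (marked_group k) :=
  fun X Y => `[< marked_iso X Y >].

Lemma marked_isob_equiv (k : nat) : equiv_class_of (@marked_isob k).
Proof.
split.
- by move=> X; apply/asboolP; exact: marked_iso_refl.
- by move=> X Y; apply/asboolP/asboolP; exact: marked_iso_sym.
- move=> Y X Z /asboolP XY /asboolP YZ; apply/asboolP.
  exact: marked_iso_trans XY YZ.
Qed.

Canonical marked_iso_equiv (k : nat) : equiv_rel (marked_group k) :=
  EquivRelPack (marked_isob_equiv k).

(* The space M_k. *)
Definition marked_space (k : nat) : Type := {eq_quot (@marked_isob k)}.
HB.instance Definition _ (k : nat) := Choice.on (marked_space k).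
HB.instance Definition _ (k : nat) := Quotient.on (marked_space k).

Definition marked_point (k : nat) (X : marked_group k) : marked_space k :=
  \pi_(marked_space k) X.

(* The relation "at distance at most 2^-n".  By cayley_ball_iso_marked_point  *)
(* it does not depend on the representatives.                                 *)
Definition marked_close (k n : nat) (p q : marked_space k) : Prop :=
  cayley_ball_iso n (repr p) (repr q).

Section MarkedSpaceTopology.
Variable k : nat.
Implicit Types p q : marked_space k.

Lemma marked_pointP (X Y : marked_group k) :
  marked_point X = marked_point Y <-> marked_iso X Y.
Proof.
split; first by move=> /eqmodP /asboolP.
by move=> XY; apply/eqmodP/asboolP.
Qed.

Lemma cayley_ball_iso_marked_point n (X Y : marked_group k) :
  marked_close n (marked_point X) (marked_point Y) <-> cayley_ball_iso n X Y.
Proof.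
have XX (Z : marked_group k) : marked_iso (repr (marked_point Z)) Z.
  by apply/marked_pointP; rewrite /marked_point reprK.
split=> XY.
  apply: cayley_ball_iso_trans (marked_iso_ball n (XX Y)).
  by apply: cayley_ball_iso_trans XY; apply/marked_iso_ball/marked_iso_sym.
apply: cayley_ball_iso_trans (marked_iso_ball n (marked_iso_sym (XX Y))).
exact: cayley_ball_iso_trans (marked_iso_ball n (XX X)) XY.
Qed.

Definition marked_nbhs p : set_system (marked_space k) :=
  [set A | exists n, [set q | marked_close n p q] `<=` A].

HB.instance Definition _ := hasNbhs.Build (marked_space k) marked_nbhs.

Lemma marked_nbhs_filter p : ProperFilter (nbhs p).
Proof.
split.
  by move=> [n /(_ p)]; apply; exact: cayley_ball_iso_refl.
split.
- by exists 0%N.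
- move=> A B [m mA] [n nB]; exists (maxn m n) => q pq; split.
    by apply: mA; apply: cayley_ball_iso_leq pq; exact: leq_maxl.
  by apply: nB; apply: cayley_ball_iso_leq pq; exact: leq_maxr.
- by move=> A B AB [n nA]; exists n => q /nA /AB.
Qed.

Lemma marked_nbhs_singleton p (A : set (marked_space k)) : nbhs p A -> A p.
Proof. by move=> [n]; apply; exact: cayley_ball_iso_refl. Qed.

Lemma marked_nbhs_nbhs p (A : set (marked_space k)) :
  nbhs p A -> nbhs p (nbhs^~ A).
Proof.
move=> [n nA]; exists n => q pq; exists n => r qr.
by apply: nA; exact: cayley_ball_iso_trans pq qr.
Qed.

HB.instance Definition _ := Nbhs_isNbhsTopological.Build (marked_space k)
  marked_nbhs_filter marked_nbhs_singleton marked_nbhs_nbhs.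

End MarkedSpaceTopology.

Definition perfect_kernel (T : topologicalType) : set T :=
  [set x | forall U : set T, open U -> U x -> ~ countable U].

Definition condensation_group (G : small_group) : Prop :=
  exists (k : nat) (S : k.-tuple G) (genS : generates S),
    (0 < k)%N /\
    perfect_kernel (marked_point (MarkedGroup genS)).

(* The balls are finite (finite_cayley_ball), so fset_set does not fall back  *)
(* on its default value.                                                      *)
Definition growth (G : groupType) (k : nat) (S : k.-tuple G) (n : nat) : nat :=
  #|` fset_set (cayley_ball S n) |.

Definition polynomially_bounded (R : realType) (u : nat -> nat) : Prop :=
  exists P : {poly R}, forall n, ((u n)%:R <= P.[n%:R])%R.

Definition exponentially_bounded_below (R : realType) (u : nat -> nat) : Prop :=
  exists2 c : R, (1 < c)%R & forall n, (c ^+ n <= (u n)%:R)%R.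

Definition intermediate_growth (R : realType) (G : groupType) : Prop :=
  exists (k : nat) (S : k.-tuple G),
    [/\ generates S,
        ~ polynomially_bounded R (growth S) &
        ~ exponentially_bounded_below R (growth S)].

Definition homeomorphic (T U : topologicalType) : Prop :=
  exists (f : T -> U) (g : U -> T),
    [/\ continuous f, continuous g, cancel f g & cancel g f].

Definition ternary_seq : Type :=
  prod_topology (fun _ : nat => discrete_topology 'I_3).
HB.instance Definition _ := Topological.on ternary_seq.

Definition constant_seq (w : ternary_seq) : Prop :=
  exists a : 'I_3, forall n : nat, w n = a.

Definition eventually_constant (w : ternary_seq) : Prop :=
  exists (a : 'I_3) (N : nat), forall n : nat, (N <= n)%N -> w n = a.

Section Lamplighter.
Local Open Scope fset_scope.
Local Open Scope ring_scope.

(* Finitely supported functions, i.e. the direct sum of copies of Z/2Z. *)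
Definition lamps : Type := {fsfun int -> 'Z_2 with 0}.
HB.instance Definition _ := Choice.on lamps.

Definition lamps0 : lamps := [fsfun].
Definition lamps_add (f g : lamps) : lamps :=
  [fsfun i in finsupp f `|` finsupp g => f i + g i].
Definition lamps_opp (f : lamps) : lamps :=
  [fsfun i in finsupp f => - f i].
Definition lamps_shift (m : int) (f : lamps) : lamps :=
  [fsfun i in [fset m + j | j in finsupp f] => f (i - m)].

Lemma lamps0E i : lamps0 i = 0. Proof. by rewrite fsfunE. Qed.

Lemma lamps_addE f g i : lamps_add f g i = f i + g i.
Proof.
rewrite fsfunE inE; case: (finsuppP f i); case: (finsuppP g i) => //=.
by rewrite addr0.
Qed.

Lemma lamps_oppE f i : lamps_opp f i = - f i.
Proof. by rewrite fsfunE; case: finsuppP => //; rewrite oppr0. Qed.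

Lemma lamps_shiftE m f i : lamps_shift m f i = f (i - m).
Proof.
rewrite fsfunE; case: imfsetP => // nfi; case: finsuppP => // fi.
by exfalso; apply: nfi; exists (i - m) => //; rewrite addrC subrK.
Qed.

Definition lampsE := (lamps0E, lamps_addE, lamps_oppE, lamps_shiftE).

(* Semidirect product of lamps and Z, the element (f, m) being f * t^m. *)
Definition lamplighter : Type := (lamps * int)%type.
HB.instance Definition _ := Choice.on lamplighter.

Definition lamplighter_mul (x y : lamplighter) : lamplighter :=
  (lamps_add x.1 (lamps_shift x.2 y.1), x.2 + y.2).
Definition lamplighter_one : lamplighter := (lamps0, 0).
Definition lamplighter_inv (x : lamplighter) : lamplighter :=
  (lamps_shift (- x.2) (lamps_opp x.1), - x.2).

Lemma lamplighter_mulA : associative lamplighter_mul.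
Proof.
move=> [f m] [g n] [h p]; congr (_, _); rewrite /= ?addrA//.
by apply/fsfunP => i; rewrite !lampsE addrA opprD addrA.
Qed.

Lemma lamplighter_mul1 : left_id lamplighter_one lamplighter_mul.
Proof.
move=> [f m]; congr (_, _); rewrite /= ?add0r//.
by apply/fsfunP => i; rewrite !lampsE subr0 add0r.
Qed.

Lemma lamplighter_mulr1 : right_id lamplighter_one lamplighter_mul.
Proof.
move=> [f m]; congr (_, _); rewrite /= ?addr0//.
by apply/fsfunP => i; rewrite !lampsE addr0.
Qed.

Lemma lamplighter_mulV :
  left_inverse lamplighter_one lamplighter_inv lamplighter_mul.
Proof.
move=> [f m]; congr (_, _); rewrite /= ?addNr//.
by apply/fsfunP => i; rewrite !lampsE addNr.
Qed.

Lemma lamplighter_mulrV :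
  right_inverse lamplighter_one lamplighter_inv lamplighter_mul.
Proof.
move=> [f m]; congr (_, _); rewrite /= ?addrN//.
by apply/fsfunP => i; rewrite !lampsE opprK subrK addrN.
Qed.

HB.instance Definition _ := isGroup.Build lamplighter
  lamplighter_mulA lamplighter_mul1 lamplighter_mulr1
  lamplighter_mulV lamplighter_mulrV.

End Lamplighter.

(* Main.v *)
From HB Require Import structures.
Require Import Defs.
From mathcomp Require Import all_boot all_order all_algebra.
From mathcomp Require Import finmap.
From mathcomp Require Import boolp classical_sets functions cardinality reals.
From mathcomp Require Import topology cantor sequences exp.
From mathcomp Require Import zify lra.

(* To a sequence om of rules in {0, 1, 2} belongs a Grigorchuk group, generated
   by an involution a and a Klein four-group V; the rule om 0 selects the
   element of V that is lost on one half of the binary tree. The group acts on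
   the orbit of one boundary point of the tree, here nat, and the base point 0
   is decorated by V, so that V stays faithful even if om is eventually
   constant. The marked group is the subgroup generated by t = b a and d.

   A word splits into two sections, words over the shifted rules, whose total
   length is that of the word up to the letters killed by the first rule. Hence
   the triviality of a word depends on finitely many rules only, and along the
   rules 0, 1, 2 lengths shrink by the factor 2/3, which forces subexponential
   growth as soon as these rules occur infinitely often. Conversely, a word in
   the second derived subgroup can be lifted to a word of twice the length that
   acts on one half of the tree only. Iterating from a single word, which is
   trivial for the first rule 0 and nontrivial for the rules 1, 2, 0, gives
   2^(2^n) elements of length O(4^n) and words that tell different rule
   sequences apart. If all rules are 0, the action is that of the lamplighter
   group on int * V.

   The rules of L w are the blocks 0, 1, 2 at the positions where w jumps and
   0, 0, 0 elsewhere. Thus L w depends on the jumps of w only, L is not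
   injective, and its range is the injective continuous image of {0,1}^N. *)

Set Implicit Arguments.
Unset Strict Implicit.
Unset Printing Implicit Defensive.

Import Order.TTheory GRing.Theory Num.Theory.

Local Open Scope classical_set_scope.

(** * The action and its sections *)

Definition klein : Set := (bool * bool)%type.
HB.instance Definition _ := Finite.on klein.

Definition kadd (x y : klein) : klein := (x.1 (+) y.1, x.2 (+) y.2).
Definition k0 : klein := (false, false).
Definition kb : klein := (true, false).
Definition kd : klein := (false, true).

Lemma kaddA x y z : kadd x (kadd y z) = kadd (kadd x y) z.
Proof. by rewrite /kadd /= !addbA. Qed.

Lemma kaddxx x : kadd x x = k0.
Proof. by rewrite /kadd !addbb. Qed.

(** The three nonzero homomorphisms from V to the group of order two. The kernel is spanned by [kd]
    for the rule 0, by [kb] for the rule 1 and by their sum otherwise. *)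
Definition phi (k : nat) (x : klein) : bool :=
  match k with 0 => x.1 | 1 => x.2 | _ => x.1 (+) x.2 end.

Lemma phiD k x y : phi k (kadd x y) = phi k x (+) phi k y.
Proof. by case: k => [|[|k]] //=; rewrite addbACA. Qed.

Definition shift (om : nat -> nat) (n : nat) : nat := om n.+1.

Definition point : Set := (nat * klein)%type.

Definition actA (y : point) : point :=
  (if odd y.1 then y.1.-1 else y.1.+1, y.2).

Definition flip (n : nat) : nat := if odd n then n.+1 else n.-1.

(** Both ends of the edge {2j-1, 2j} have [uphalf] equal to j, and the 2-adic valuation of j is the
    level of the tree whose rule decides about this edge. *)
Definition label (om : nat -> nat) (n : nat) : nat := om (logn 2 (uphalf n)).

Definition actV (om : nat -> nat) (x : klein) (y : point) : point :=
  if y.1 == 0 then (0, kadd x y.2)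
  else (if phi (label om y.1) x then flip y.1 else y.1, y.2).

(* The vertices form a ray 0, 1, 2, ... whose edges {2j, 2j+1} are moved by [a]
   and {2j-1, 2j} by [V] (Gray code); [emb false] and [emb true] enumerate the
   two halves of the tree, which [a] exchanges. *)
Definition emb (b : bool) (y : point) : point :=
  (y.1.*2 + (odd y.1 (+) b), y.2).

Lemma actAK : involutive actA.
Proof.
case=> n v; rewrite /actA /=; case on: (odd n) => /=; last by rewrite on.
by case: n on => //= n /negbTE ->.
Qed.

Lemma flip_gt0 n : 0 < n -> 0 < flip n.
Proof. by rewrite /flip; case: ifP => //; case: n => [|[|]]. Qed.

Lemma flipK n : 0 < n -> flip (flip n) = n.
Proof.
rewrite /flip; case on: (odd n) => /=; first by rewrite on.
by case: n on => //= n /negbFE ->.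
Qed.

Lemma uphalf_flip n : 0 < n -> uphalf (flip n) = uphalf n.
Proof.
by rewrite /flip !uphalfE; case: ifP => on; case: n on => //= n; lia.
Qed.

Lemma actVD om x x' y : actV om x (actV om x' y) = actV om (kadd x x') y.
Proof.
case: y => n v; rewrite /actV /=; case: (posnP n) => [//|n0] /=.
  by rewrite kaddA.
rewrite phiD /label; case: (phi _ x') => /=; last first.
  by rewrite (gtn_eqF n0) addbF.
rewrite (gtn_eqF (flip_gt0 n0)) uphalf_flip// flipK//.
by case: (phi _ x).
Qed.

Lemma actV0 om y : actV om k0 y = y.
Proof.
case: y => n [v1 v2]; rewrite /actV /=; case: eqP => [->//|_].
by case: (label om n) => [|[|]].
Qed.

Lemma actVK om x : involutive (actV om x).
Proof. by move=> y; rewrite actVD kaddxx actV0. Qed.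

Lemma actA_emb b y : actA (emb b y) = emb (~~ b) y.
Proof.
case: y => n v; rewrite /actA /emb /= oddD odd_double /=.
by rewrite oddb; case: (odd n); case: b => /=; congr (_, _); lia.
Qed.

Lemma actV_emb_false om x y :
  actV om x (emb false y) = emb false (actV (shift om) x y).
Proof.
case: y => n v; rewrite /actV /emb /label /=; case: (posnP n) => [->//|n0] /=.
have -> : (n.*2 + (odd n (+) false) == 0) = false by lia.
rewrite /= addbF.
have -> : uphalf (n.*2 + odd n) = 2 * uphalf n.
  by rewrite uphalf_half mul2n; case: (boolP (odd n)); rewrite uphalf_half; lia.
rewrite lognM ?uphalf_gt0// logn_prime//= /shift add1n.
case: ifP => _; rewrite addbF //; congr (_, _); rewrite /flip oddD odd_double oddb /=.
by case: ifP => on; rewrite /= ?on /=; lia.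
Qed.

Lemma actV_emb_true om x y :
  actV om x (emb true y) = emb true (if phi (om 0) x then actA y else y).
Proof.
case: y => n v; rewrite /actV /emb /label /=.
have -> : (n.*2 + (odd n (+) true) == 0) = false by lia.
have u_odd : odd (uphalf (n.*2 + (odd n (+) true))).
  by rewrite uphalf_half; case: (boolP (odd n)) => /=; lia.
have -> : logn 2 (uphalf (n.*2 + (odd n (+) true))) = 0.
  by apply/eqP; rewrite -leqn0 leqNgt logn_gt0 mem_primes /= dvdn2 u_odd !andbF.
case: ifP => _ //; rewrite /flip /actA /= oddD odd_double oddb /=.
congr (_, _); case: (boolP (odd n)) => on /=; rewrite ?on /=; last by lia.
by case: n on {u_odd} => //= n; lia.
Qed.

Lemma embP y : exists b y', y = emb b y'.
Proof.
case: y => n v; exists (odd n (+) odd n./2), (n./2, v).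
by rewrite /emb /= addbC addbK; congr (_, _); lia.
Qed.

Lemma emb_inj b b' y y' : emb b y = emb b' y' -> b = b' /\ y = y'.
Proof.
have half_inj (m m' : nat) (c c' : bool) : m.*2 + c = m'.*2 + c' -> m = m' /\ c = c'.
  by case: c; case: c' => /=; lia.
case: y y' => n v [n' v'] [] /half_inj[<- e] <-; split=> //.
exact: addbI e.
Qed.

Definition ev (om : nat -> nat) (s : seq klein) (y : point) : point :=
  foldr (fun x z => actV om x (actA z)) y s.

Lemma ev_cat om s s' y : ev om (s ++ s') y = ev om s (ev om s' y).
Proof. by rewrite /ev foldr_cat. Qed.

(** The normal form x1 a ... xn a z. With the last factor z in V, multiplication by V on the left
    never adds a letter. *)
Definition kword : Set := (seq klein * klein)%type.

Definition evx (om : nat -> nat) (w : kword) (y : point) : point :=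
  ev om w.1 (actV om w.2 y).

Definition lmulV (x : klein) (w : kword) : kword :=
  if w.1 is x0 :: s then (kadd x x0 :: s, w.2) else ([::], kadd x w.2).

Definition lmulA (w : kword) : kword := (k0 :: w.1, w.2).

Lemma evx_lmulV om x w y : evx om (lmulV x w) y = actV om x (evx om w y).
Proof. by case: w => [[|x0 s] z]; rewrite /evx /= actVD. Qed.

Lemma evx_lmulA om w y : evx om (lmulA w) y = actA (evx om w y).
Proof. by rewrite /evx /= actV0. Qed.

(** The word acts from its right end, and the parity of the number of a applied so far tells which
    half is reached. On the half [false] a letter acts as itself for the shifted rules, on the half
    [true] as a power of a. *)
Fixpoint sect_rec (k : nat) (b : bool) (s : seq klein) (z : klein) : kword :=
  if s is x :: s' then
    let u := sect_rec k b s' z in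
    if b (+) odd (size s') then lmulV x u
    else if phi k x then lmulA u else u
  else if b then if phi k z then ([:: k0], k0) else ([::], k0) else ([::], z).

Definition sect (k : nat) (b : bool) (w : kword) := sect_rec k b w.1 w.2.

Lemma evx_emb om w b y :
  evx om w (emb b y) =
  emb (b (+) odd (size w.1)) (evx (shift om) (sect (om 0) b w) y).
Proof.
case: w => s z; rewrite /evx /sect /=.
elim: s => [|x s IH] /=.
  rewrite addbF; case: b; last by rewrite actV_emb_false.
  rewrite actV_emb_true; congr (emb _ _).
  by case: ifP; rewrite /= !actV0.
rewrite IH actA_emb -[ev _ _ _]/(evx _ _ _).
rewrite addbN; case: (b (+) odd (size s)) => /=.
  by rewrite actV_emb_false -evx_lmulV.
rewrite actV_emb_true; case: ifP => _ //.
by rewrite -evx_lmulA.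
Qed.

Lemma size_lmulV x w : size (lmulV x w).1 = size w.1.
Proof. by case: w => [[|]]. Qed.

Lemma size_sect k b w :
  size (sect k b w).1 <= if b then (size w.1)./2.+1 else uphalf (size w.1).
Proof.
case: w => s z; rewrite /sect /=.
elim: s => [|x s IH] /=; first by case: b => //; case: ifP.
case: (boolP (b (+) odd (size s))) => o.
  rewrite size_lmulV (leq_trans IH)//; case: b o {IH}; rewrite uphalf_half; lia.
case: ifP => _ /=; case: b IH o => /=; rewrite !uphalf_half; lia.
Qed.

Definition acts_trivially om w := forall y, evx om w y = y.

Lemma acts_trivially_sect om w :
  acts_trivially om w <->
  ~~ odd (size w.1) /\ forall b, acts_trivially (shift om) (sect (om 0) b w).
Proof.
split=> [tw|[/negbTE ow tw] y].
  have ow : ~~ odd (size w.1).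
    have := tw (emb false (0, k0)); rewrite evx_emb => /emb_inj[].
    by rewrite addFb => ->.
  split=> // b y; have := tw (emb b y); rewrite evx_emb => /emb_inj[_].
  by [].
by have [b [y' ->]] := embP y; rewrite evx_emb ow addbF tw.
Qed.

(** The base point decides: a moves it to position 1, while V acts faithfully on its decoration. *)
Lemma actV_neq_actA om z e :
  (forall y, actV om z y = if e then actA y else y) -> e = false /\ z = k0.
Proof.
move=> /(_ (0, k0)); rewrite /actV /actA /=; case: e => //=.
by case: z => [[] []].
Qed.

(** Comparing a x1 a with x0 + z on the two halves identifies elements of V with powers of a, so
    both are trivial. The criterion is free of the rules. *)
Lemma acts_trivially_size2 om x0 x1 z :
  acts_trivially om ([:: x0; x1], z) <-> x1 = k0 /\ x0 = z.
Proof.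
split=> [tw|[-> ->] y]; last first.
  by rewrite /evx /= actV0 actAK actVK.
have E y : actA (actV om x1 (actA y)) = actV om (kadd x0 z) y.
  have := tw (actV om z y); rewrite /evx /= actVK => /(congr1 (actV om x0)).
  by rewrite actVK actVD.
have E0 y : actV (shift om) (kadd x0 z) y = if phi (om 0) x1 then actA y else y.
  have := E (emb false y); rewrite actA_emb actV_emb_true actA_emb actV_emb_false.
  by move=> /emb_inj[_ ->].
have E1 y : actV (shift om) x1 y = if phi (om 0) (kadd x0 z) then actA y else y.
  have := E (emb true y); rewrite actA_emb actV_emb_false actA_emb actV_emb_true.
  by move=> /emb_inj[_ ->].
split; first by have [] := actV_neq_actA E1.
have [_] := actV_neq_actA E0.
by case: x0 {tw E E0 E1} => [[] []]; case: z => [[] []].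
Qed.

Lemma acts_trivially_size0 om z : acts_trivially om ([::], z) <-> z = k0.
Proof.
split=> [tw|-> y]; last by rewrite /evx /= actV0.
by have [] := @actV_neq_actA om z false tw.
Qed.

Lemma acts_trivially_local n om w : size w.1 <= n ->
  exists N, forall om', (forall i, i < N -> om' i = om i) ->
    (acts_trivially om' w <-> acts_trivially om w).
Proof.
elim/ltn_ind: n om w => n IH om w wn.
have [ow|ow] := boolP (odd (size w.1)).
  by exists 0 => om' _; rewrite !acts_trivially_sect ow; split=> -[].
(* From length 4 on, the sections are strictly shorter than the word; the even lengths 0 and 2 have
   criteria free of the rules. *)
have [w4|w3] := leqP 4 (size w.1).
  have sz b : size (sect (om 0) b w).1 < n.
    apply: leq_trans wn; rewrite (leq_ltn_trans (size_sect _ _ _))//.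
    by rewrite uphalf_half; case: b; lia.
  have [N0 HN0] := IH _ (sz false) (shift om) _ (leqnn _).
  have [N1 HN1] := IH _ (sz true) (shift om) _ (leqnn _).
  exists (maxn N0 N1).+1 => om' omE; rewrite !(acts_trivially_sect _ w) omE//.
  have om1 i : i < N0 -> shift om' i = shift om i.
    by move=> iN; apply: omE; rewrite ltnS leq_max iN.
  have om2 i : i < N1 -> shift om' i = shift om i.
    by move=> iN; apply: omE; rewrite ltnS leq_max iN orbT.
  by split=> -[e t]; split=> // -[]; apply/(HN0 _ om1) || apply/(HN1 _ om2); exact: t.
exists 0 => om' _; case: w ow w3 {wn} => -[|x0 [|x1 [|x2 [|//]]]] z //= _ _.
  by rewrite !acts_trivially_size0.
by rewrite !acts_trivially_size2.
Qed.

(** * Weights of words and of their sections *)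

Definition wsum (W : klein -> nat) (s : seq klein) := sumn (map W s).

Lemma wsum_lmulV (h : nat) (mu : klein -> nat) x w :
  (forall y z, mu (kadd y z) <= mu y + mu z) ->
  wsum (fun y => h + mu y) (lmulV x w).1 <=
  mu x + wsum (fun y => h + mu y) w.1.
Proof.
move=> muD; case: w => [[|y s] z] //=; rewrite /wsum /=.
by have := muD x y; lia.
Qed.

(** Each letter x enters one section as an element of V, costing at most [mu x] by subadditivity,
    and the other as a power of a, costing h if [phi k x]. The final h pays for the last factor of
    the word. *)
Lemma wsum_sect (h : nat) (mu : klein -> nat) k w :
  mu k0 = 0 -> (forall y z, mu (kadd y z) <= mu y + mu z) ->
  wsum (fun y => h + mu y) (sect k false w).1 +
  wsum (fun y => h + mu y) (sect k true w).1 <=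
  wsum (fun x => mu x + h * phi k x) w.1 + h.
Proof.
move=> mu0 muD; case: w => s z; rewrite /sect /=.
elim: s => [|x s IH] /=.
  by rewrite /wsum; case: ifP; rewrite /= ?mu0; lia.
set u := sect_rec _ _ _ _ in IH *; set v := sect_rec _ _ _ _ in IH *.
have Hu := wsum_lmulV h x u muD; have Hv := wsum_lmulV h x v muD.
have A t : wsum (fun y => h + mu y) (if phi k x then lmulA t else t).1 =
    h * phi k x + wsum (fun y => h + mu y) t.1.
  by case: (phi k x) => //=; rewrite /wsum /= ?mu0; lia.
rewrite {3}/wsum /= -/(wsum _ s).
by case: (odd (size s)) => /=; rewrite A; lia.
Qed.

(** * Lifting words to one half of the tree *)

Definition lift_letter (k : nat) : klein := (k != 1, k == 1).

Lemma phi_lift_letter k : phi k (lift_letter k).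
Proof. by case: k => [|[|k]]. Qed.

(** With l the lifting letter, x a l a preserves each half. On the half [false], l acts there as the
    missing a and x as itself. *)
Definition lift (k : nat) (s : seq klein) : seq klein :=
  flatten [seq [:: x; lift_letter k] | x <- s].

Lemma size_lift k s : size (lift k s) = (size s).*2.
Proof. by elim: s => //= x s ->. Qed.

Lemma ev_lift_false om s y :
  ev om (lift (om 0) s) (emb false y) = emb false (ev (shift om) s y).
Proof.
elim: s => //= x s ->; rewrite actA_emb actV_emb_true phi_lift_letter actA_emb.
by rewrite actV_emb_false.
Qed.

(* On the half of the tree to which a word is not lifted, [a] acts as an element
   of [V] and [V] acts through powers of [a], see [ev_lift_true]. *)
Definition dihedral_trivial (s : seq klein) : Prop :=
  forall (al be : point -> point) (psi : klein -> bool),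
    involutive al -> involutive be -> psi k0 = false ->
    (forall x y, psi (kadd x y) = psi x (+) psi y) ->
    forall y, foldr (fun x z => (if psi x then be else id) (al z)) y s = y.

Lemma ev_lift_true om s y : dihedral_trivial s ->
  ev om (lift (om 0) s) (emb true y) = emb true y.
Proof.
move=> ds; have phi0 : phi (om 0) k0 = false by case: (om 0) => [|[|]].
have dsy := ds _ _ (phi (om 0)) (actVK (shift om) (lift_letter (om 0))) actAK
  phi0 (phiD _) y.
rewrite -[in RHS]dsy; elim: s {ds dsy} => //= x s ->.
by rewrite actA_emb actV_emb_false actA_emb actV_emb_true; case: ifP.
Qed.

(** The lifted word acts as the original one with [al] replaced by [al be^c al], which is again an
    involution. *)
Lemma dihedral_trivial_lift k s :
  dihedral_trivial s -> dihedral_trivial (lift k s).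
Proof.
move=> ds al be psi alK beK psi0 psiD y.
set c := psi (lift_letter k).
pose al' z := al ((if c then be else id) (al z)).
have al'K : involutive al'.
  by move=> z; rewrite /al'; case: (c); rewrite ?alK ?beK ?alK.
rewrite -[RHS](ds al' be psi al'K beK psi0 psiD).
by elim: s {ds} => //= x s ->; rewrite -/c /al'; case: (c).
Qed.

Lemma dihedral_trivial_cat s s' :
  dihedral_trivial s -> dihedral_trivial s' -> dihedral_trivial (s ++ s').
Proof.
move=> ds ds' al be psi alK beK psi0 psiD y.
by rewrite foldr_cat ds'// ds.
Qed.

Lemma dihedral_trivial_conj s :
  dihedral_trivial s -> dihedral_trivial (k0 :: s ++ [:: k0]).
Proof.
move=> ds al be psi alK beK psi0 psiD y /=.
by rewrite psi0 foldr_cat ds//= psi0 alK.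
Qed.

Lemma dihedral_trivial_nil : dihedral_trivial [::]. Proof. by []. Qed.

(* [[d, ada], [d, aca]], each letter [x] standing for [x a] as in [ev]. *)
Definition bicomm : seq klein :=
  let c := (true, true) in
  [:: kd; kd; kd; kd; kd; c; kd; c;
      k0; kd; kd; kd; kd; k0; k0; c; kd; c; kd; k0].

(** Dihedral groups are metabelian, so a commutator of commutators vanishes. For each of the four
    values of [psi] on d and c the word cancels. *)
Lemma dihedral_trivial_bicomm : dihedral_trivial bicomm.
Proof.
move=> al be psi alK beK psi0 psiD y; rewrite /= psi0.
by case: (psi kd); case: (psi (true, true)); rewrite !(alK, beK).
Qed.

(** Under the rule 0, d acts on one half only, so it commutes with a d a and the inner commutator
    [d, ada] already vanishes. *)
Lemma ev_bicomm0 om : om 0 = 0 -> forall y, ev om bicomm y = y.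
Proof.
move=> om0 y; have dd z : ev om [:: kd; kd; kd; kd] z = z.
  have [b [z' ->]] := embP z; rewrite /ev /=.
  by case: b; do 4 rewrite actA_emb ?actV_emb_true ?actV_emb_false ?om0 /=; rewrite ?actVK.
have dd' z : ev om [:: k0; kd; kd; kd; kd; k0] z = z.
  rewrite -[[:: k0; _; _; _; _; _]]/([:: k0] ++ [:: kd; kd; kd; kd] ++ [:: k0]).
  by rewrite !ev_cat dd /= !actV0 actAK.
pose c : klein := (true, true).
rewrite -[bicomm]/([:: kd; kd; kd; kd] ++ [:: kd; c; kd; c] ++
  [:: k0; kd; kd; kd; kd; k0] ++ [:: k0; c; kd; c; kd; k0]).
rewrite !ev_cat dd dd' /= !actV0.
by rewrite !(actAK, actVK).
Qed.

(** Three successive sections on the half [true], along the rules 1, 2, 0, leave a word with an odd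
    number of a, which exchanges the halves. *)
Lemma ev_bicomm1 om : om 0 = 1 -> om 1 = 2 -> om 2 = 0 ->
  ~ (forall y, ev om bicomm y = y).
Proof.
move=> om0 om1 om2 tr.
have : acts_trivially om (bicomm, k0).
  by move=> y; rewrite -[LHS]/(ev om bicomm (actV om k0 y)) actV0.
move=> /acts_trivially_sect[_] /(_ true); rewrite om0.
move=> /acts_trivially_sect[_] /(_ true); rewrite [shift om 0]om1.
move=> /acts_trivially_sect[_] /(_ true); rewrite [shift _ 0]om2.
by move=> /acts_trivially_sect[].
Qed.

(** * Doubly exponential families and test words *)

Fixpoint lift_family (om : nat -> nat) (n : nat) : seq (seq klein) :=
  if n is n'.+1 then
    let F := lift_family (shift om) n' in
    [seq lift (om 0) s ++ k0 :: lift (om 0) s' ++ [:: k0] | s <- F, s' <- F]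
  else [:: [::]; bicomm].

Fixpoint shiftn (n : nat) (om : nat -> nat) : nat -> nat :=
  if n is n'.+1 then shiftn n' (shift om) else om.

Lemma shiftnE n om i : shiftn n om i = om (n + i).
Proof. by elim: n om i => //= n IH om i; rewrite IH. Qed.

Lemma size_lift_family om n : size (lift_family om n) = 2 ^ (2 ^ n).
Proof.
elim: n om => //= n IH om.
by rewrite size_allpairs IH -expnD addnn expnS mul2n.
Qed.

Lemma lift_family_dihedral_trivial om n s :
  s \in lift_family om n -> dihedral_trivial s.
Proof.
elim: n om s => [|n IH] om s /=.
  rewrite !inE => /orP[]/eqP->; first exact: dihedral_trivial_nil.
  exact: dihedral_trivial_bicomm.
case/allpairsP => -[s1 s2] /= [/IH d1 /IH d2 ->].
apply: dihedral_trivial_cat; first exact: dihedral_trivial_lift.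
by apply: dihedral_trivial_conj; exact: dihedral_trivial_lift.
Qed.

(** The word [bicomm] has length 20 = 21 - 1, and a pair of words of length at most L yields length
    at most 4 L + 2. *)
Lemma lift_family_size om n s :
  s \in lift_family om n -> size s <= 21 * 4 ^ n - 1.
Proof.
elim: n om s => [|n IH] om s /=.
  by rewrite !inE => /orP[]/eqP->.
case/allpairsP => -[s1 s2] /= [/IH d1 /IH d2 ->].
have : 0 < 4 ^ n by rewrite expn_gt0.
rewrite !size_cat /= !size_cat !size_lift expnS /=.
by move: (size s1) (size s2) (4 ^ n) d1 d2 => ? ? ?; lia.
Qed.

Lemma ev_lift_pair om s1 s2 b y :
  dihedral_trivial s1 -> dihedral_trivial s2 ->
  ev om (lift (om 0) s1 ++ k0 :: lift (om 0) s2 ++ [:: k0]) (emb b y) =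
  emb b (ev (shift om) (if b then s2 else s1) y).
Proof.
move=> d1 d2; rewrite ev_cat -cat1s !ev_cat /= !actV0 actA_emb.
case: b => /=.
  by rewrite ev_lift_false actA_emb ev_lift_true.
by rewrite ev_lift_true// actA_emb ev_lift_false.
Qed.

(** The actions on the two halves recover both components of a pair, down to level n, where the
    rules 1, 2, 0 make [bicomm] nontrivial. *)
Lemma lift_family_ev_inj om n : om n = 1 -> om n.+1 = 2 -> om n.+2 = 0 ->
  forall s s', s \in lift_family om n -> s' \in lift_family om n ->
  ev om s =1 ev om s' -> s = s'.
Proof.
elim: n om => [|n IH] om om0 om1 om2 s s' /=.
  rewrite !inE => /orP[]/eqP-> /orP[]/eqP->// e; exfalso;
    by apply: (ev_bicomm1 om0 om1 om2) => y; rewrite (e y) || rewrite -(e y).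
case/allpairsP => -[s1 s2] /= [s1F s2F ->].
case/allpairsP => -[t1 t2] /= [t1F t2F ->] e.
have [ds1 ds2] := (lift_family_dihedral_trivial s1F, lift_family_dihedral_trivial s2F).
have [dt1 dt2] := (lift_family_dihedral_trivial t1F, lift_family_dihedral_trivial t2F).
have eb b : ev (shift om) (if b then s2 else s1) =1 ev (shift om) (if b then t2 else t1).
  move=> y; have := e (emb b y); rewrite !ev_lift_pair//.
  by move=> /emb_inj[].
have -> : s1 = t1 by exact: (IH (shift om) _ _ _ _ _ s1F t1F (eb false)).
by have -> : s2 = t2 by exact: (IH (shift om) _ _ _ _ _ s2F t2F (eb true)).
Qed.

Lemma uniq_lift_family om n : om n = 1 -> om n.+1 = 2 -> om n.+2 = 0 ->
  uniq (lift_family om n).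
Proof.
elim: n om => // n IH om om0 om1 om2 /=.
have uF := IH (shift om) om0 om1 om2.
apply: allpairs_uniq => // -[s1 s2] [t1 t2] /allpairsP[[a a'] /= [s1F s2F [ea ea']]].
rewrite -{a}ea in s1F; rewrite -{a'}ea' in s2F.
move=> /allpairsP[[a a'] /= [t1F t2F [ea ea']]] e.
rewrite -{a}ea in t1F; rewrite -{a'}ea' in t2F.
have [ds1 ds2] := (lift_family_dihedral_trivial s1F, lift_family_dihedral_trivial s2F).
have [dt1 dt2] := (lift_family_dihedral_trivial t1F, lift_family_dihedral_trivial t2F).
have eb b : ev (shift om) (if b then s2 else s1) =1 ev (shift om) (if b then t2 else t1).
  move=> y; have := ev_lift_pair om b y ds1 ds2; rewrite e ev_lift_pair//.
  by move=> /emb_inj[].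
have -> : s1 = t1 by exact: (@lift_family_ev_inj (shift om) n _ _ _ _ _ s1F t1F (eb false)).
by have -> : s2 = t2 by exact: (@lift_family_ev_inj (shift om) n _ _ _ _ _ s2F t2F (eb true)).
Qed.

(** Lifted n times, [bicomm] tests the rules from n on, while the word itself depends only on the
    rules before n. *)
Fixpoint lift_word (om : nat -> nat) (n : nat) : seq klein :=
  if n is n'.+1 then lift (om 0) (lift_word (shift om) n') else bicomm.

Lemma lift_word_dihedral_trivial om n : dihedral_trivial (lift_word om n).
Proof.
elim: n om => [|n IH] om /=; first exact: dihedral_trivial_bicomm.
exact: dihedral_trivial_lift.
Qed.

Lemma lift_word_ext om om' n : (forall i, i < n -> om i = om' i) ->
  lift_word om n = lift_word om' n.
Proof.
elim: n om om' => //= n IH om om' e; rewrite e// (IH (shift om) (shift om'))//.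
by move=> i i_n; exact: e.
Qed.

Lemma ev_lift_word om n :
  (forall y, ev om (lift_word om n) y = y) <->
  (forall y, ev (shiftn n om) bicomm y = y).
Proof.
elim: n om => [|n IH] om; first exact: iff_refl.
rewrite [shiftn _ _]/= -IH [lift_word _ _]/=; split=> e y.
  by have := e (emb false y); rewrite ev_lift_false => /emb_inj[].
have [b [{}y ->]] := embP y; case: b; last by rewrite ev_lift_false e.
by rewrite ev_lift_true//; exact: lift_word_dihedral_trivial.
Qed.

(** * Words over the generators t and d *)

Definition winv (k : nat) (w : word k) : word k := rev [seq (~~ x.1, x.2) | x <- w].

Lemma size_winv k (w : word k) : size (winv w) = size w.
Proof. by rewrite size_rev size_map. Qed.

Lemma winvK k : involutive (@winv k).
Proof.
move=> w; rewrite /winv map_rev revK -map_comp -[RHS]map_id; apply: eq_map.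
by move=> [b i]; rewrite /= negbK.
Qed.

Section Generators.
Variable om : nat -> nat.

Definition lgen (i : 'I_2) (y : point) : point :=
  if i == ord0 then actV om kb (actA y) else actV om kd y.

Definition lgenV (i : 'I_2) (y : point) : point :=
  if i == ord0 then actA (actV om kb y) else actV om kd y.

Definition weval (w : word 2) (y : point) : point :=
  foldr (fun (x : bool * 'I_2) z => if x.1 then lgenV x.2 z else lgen x.2 z) y w.

Lemma weval_cat w w' y : weval (w ++ w') y = weval w (weval w' y).
Proof. by rewrite /weval foldr_cat. Qed.

Lemma lgenVK i : cancel (lgenV i) (lgen i).
Proof. by move=> y; rewrite /lgen /lgenV; case: eqP => _; rewrite ?actAK actVK. Qed.

Lemma lgenK i : cancel (lgen i) (lgenV i).
Proof. by move=> y; rewrite /lgen /lgenV; case: eqP => _; rewrite actVK ?actAK. Qed.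

Lemma wevalK w : cancel (weval w) (weval (winv w)).
Proof.
elim: w => // -[b i] w IH y; rewrite /winv [rev _]/= rev_cons -cats1 weval_cat /=.
by case: b; rewrite /= ?lgenK ?lgenVK IH.
Qed.

End Generators.

(** In letters standing for x a, the inverse of t is a b = (0 a)(b a)(0 a), and d = (d a)(0 a). *)
Definition to_klein (w : word 2) : seq klein :=
  flatten [seq if x.2 == ord0 then (if x.1 then [:: k0; kb; k0] else [:: kb])
               else [:: kd; k0] | x <- w].

Lemma ev_to_klein om w y : ev om (to_klein w) y = weval om w y.
Proof.
rewrite /to_klein; elim: w => //= -[b i] w IH.
rewrite ev_cat IH /lgen /lgenV /=.
by case: eqP => _; case: b; rewrite /= ?actV0 ?actAK.
Qed.

Lemma size_to_klein w : size (to_klein w) <= 3 * size w.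
Proof.
rewrite /to_klein; elim: w => //= -[b i] w IH; rewrite size_cat.
by case: eqP => _; case: b; rewrite /=; lia.
Qed.

(* Pushing the involution [b] to the right through [x a = b^(1+x.1) d^(x.2) t];
   [b] commutes with [d] and inverts [t = b a]. *)
Fixpoint of_klein (e : bool) (s : seq klein) : word 2 :=
  if s is x :: s' then
    let u := (~~ (e (+) x.1), ord0) :: of_klein (~~ (e (+) x.1)) s' in
    if x.2 then (false, ord_max) :: u else u
  else [::].

Fixpoint sign (e : bool) (s : seq klein) : bool :=
  if s is x :: s' then sign (~~ (e (+) x.1)) s' else e.

Lemma weval_of_klein om e s y :
  weval om (of_klein e s) (if sign e s then actV om kb y else y) =
  (if e then actV om kb (ev om s y) else ev om s y).
Proof.
elim: s e => //= x s IH e; set z := if sign _ _ then _ else _.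
have -> w : weval om (if x.2 then (false, ord_max) :: w else w) z =
    (if x.2 then actV om kd (weval om w z) else weval om w z).
  by case: x.2.
rewrite /= IH /lgen /lgenV /=.
have -> v : actV om x v = actV om (x.1, false) (actV om (false, x.2) v).
  by rewrite actVD; case: (x) => [[] []].
case: x {z} => [[] []]; case: e; rewrite /= ?(actVK, actV0, actVD)//.
Qed.

Lemma size_of_klein e s : size (of_klein e s) <= 2 * size s.
Proof.
elim: s e => //= x s IH e; have := IH (~~ (e (+) x.1)).
by case: x.2 => /=; lia.
Qed.

Lemma sign_cat e s s' : sign e (s ++ s') = sign (sign e s) s'.
Proof. by elim: s e => //=. Qed.

Lemma signE e s : sign e s = e (+) sign false s.
Proof.
elim: s e => [|x s IH] e /=; first by rewrite addbF.
by rewrite IH [in RHS]IH addbA; congr (_ (+) _); case: e; case: x.1.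
Qed.

Lemma sign_lift e k s : ~~ odd (size s) -> sign e (lift k s) = sign e s.
Proof.
(* If the lifting letter contains b, the letters x and l together change the sign as x does. For the
   rule 1 it is d, and each x brings one extra change. *)
suff H : forall e, sign e (lift k s) = sign e s (+) (odd (size s) && (k == 1)).
  by move=> /negbTE os; rewrite H os addbF.
elim: s => [|x s IH] {}e /=; first by rewrite addbF.
rewrite IH /= signE [in RHS]signE.
by case: (k == 1) => //=; case: (odd (size s)); case: e; case: x.1; case: (sign false s).
Qed.

(** No b is left over at the right end, so the word acts as an element of the subgroup generated by
    t and d. Even length makes this stable under lifting. *)
Definition even_word (s : seq klein) := ~~ odd (size s) && ~~ sign false s.

Lemma even_word_lift k s : even_word s -> even_word (lift k s).
Proof.
case/andP => os ss; rewrite /even_word size_lift odd_double /=.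
by rewrite sign_lift.
Qed.

Lemma even_word_pair s s' :
  even_word s -> even_word s' -> even_word (s ++ k0 :: s' ++ [:: k0]).
Proof.
move=> /andP[os /negbTE ss] /andP[os' /negbTE ss']; rewrite /even_word.
rewrite !size_cat /= size_cat addn1 addnS oddS oddD oddS negbK.
rewrite (negbTE os) (negbTE os') /= sign_cat ss /= sign_cat /=.
by rewrite signE ss'.
Qed.

Lemma weval_of_even_word om s y :
  even_word s -> weval om (of_klein false s) y = ev om s y.
Proof.
by move=> /andP[_ /negbTE ss]; have := weval_of_klein om false s y; rewrite ss.
Qed.

Lemma even_word_bicomm : even_word bicomm. Proof. by []. Qed.

Lemma even_word_lift_word om n : even_word (lift_word om n).
Proof.
elim: n om => [|n IH] om /=; first exact: even_word_bicomm.
exact: even_word_lift.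
Qed.

Lemma even_word_lift_family om n s : s \in lift_family om n -> even_word s.
Proof.
elim: n om s => [|n IH] om s /=; first by rewrite !inE => /orP[]/eqP->.
case/allpairsP => -[s1 s2] /= [/IH d1 /IH d2 ->].
by apply: even_word_pair; exact: even_word_lift.
Qed.

Lemma size_lift_word om n : size (lift_word om n) = 20 * 2 ^ n.
Proof.
by elim: n om => //= n IH om; rewrite size_lift IH expnS; lia.
Qed.

(** * Upper bound for the growth *)

Definition unemb (y : point) : bool * point :=
  (odd y.1 (+) odd y.1./2, (y.1./2, y.2)).

Lemma unembK y : emb (unemb y).1 (unemb y).2 = y.
Proof.
by case: y => n v; rewrite /emb /= addbC addbK; congr (_, _); lia.
Qed.

Definition glue (o : bool) (f g : point -> point) (y : point) : point :=
  let: (b, z) := unemb y in emb (b (+) o) (if b then g z else f z).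

Lemma evx_glue om w :
  evx om w = glue (odd (size w.1)) (evx (shift om) (sect (om 0) false w))
                  (evx (shift om) (sect (om 0) true w)).
Proof.
apply/funext => y; rewrite -{1}[y]unembK evx_emb /glue.
by case: (unemb y) => -[].
Qed.

Section Upper.
Local Open Scope ring_scope.
Variable R : realType.

Definition covers (om : nat -> nat) (W : klein -> nat) (m : nat)
    (l : seq (point -> point)) : Prop :=
  forall w : kword, (wsum W w.1 <= m)%N -> evx om w \in l.

(** Exponential growth rate at most [mu] for the weight [W]. Asking only for rates above [mu] leaves
    room to absorb polynomial factors. *)
Definition tame (om : nat -> nat) (W : klein -> nat) (mu : R) : Prop :=
  forall mu', mu < mu' -> exists C : R, forall m, exists l,
    (size l)%:R <= C * expR (mu' * m%:R) /\ covers om W m l.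

Lemma size_flatten_map_le (I : eqType) (T : Type) (F : I -> seq T) (B : R) r :
  (forall i, i \in r -> (size (F i))%:R <= B) ->
  (size (flatten [seq F i | i <- r]))%:R <= (size r)%:R * B.
Proof.
elim: r => [|i r IH] FB /=; first by rewrite mul0r.
rewrite size_cat natrD -addn1 natrD mulrDl mul1r addrC lerD//.
  by apply: IH => j jr; apply: FB; rewrite inE jr orbT.
by apply: FB; rewrite mem_head.
Qed.

Lemma natr_le_expR (d : R) (M : nat) : 0 < d ->
  M.+1%:R <= (1 + d^-1) * expR (d * M%:R).
Proof.
move=> d0; apply: (@le_trans _ _ ((1 + d^-1) * (1 + d * M%:R))).
  rewrite mulrDl mul1r mulrDr mulr1 mulrA mulVf ?gt_eqF// mul1r -addn1 natrD.
  have : 0 < d^-1 by rewrite invr_gt0.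
  have : 0 <= d * M%:R by rewrite mulr_ge0// ltW.
  by set a := d * _; set b := d^-1; set c := M%:R; move=> ? ?; lra.
by rewrite ler_wpM2l ?expR_ge1Dx// addr_ge0// invr_ge0 ltW.
Qed.

(** An action is determined by a parity and two sections of total weight at most M = m + h. Summing
    over the splits i + (M - i) costs a factor M + 1. *)
Lemma tame_step om W (h : nat) (nu : klein -> nat) mu :
  nu k0 = 0%N -> (forall y z, (nu (kadd y z) <= nu y + nu z)%N) ->
  (forall x, (nu x + h * phi (om 0) x <= W x)%N) -> 0 <= mu ->
  tame (shift om) (fun x => (h + nu x)%N) mu -> tame om W mu.
Proof.
move=> nu0 nuD nuW mu0 T mu' mumu'.
(* Half of the gap serves as slack for the sections, the other half absorbs M + 1. *)
pose mu'' := (mu + mu') / 2; pose d := mu' - mu''.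
have mu''mu : mu < mu'' by rewrite /mu''; lra.
have d0 : 0 < d by rewrite /d /mu''; lra.
have [C HC] := T _ mu''mu.
have [l Hl] := boolp.choice HC.
exists ((1 + d^-1) * (2 * C ^+ 2) * expR (mu' * h%:R)) => m.
pose M := (m + h)%N.
pose pairs i := [seq (f, g) | f <- l i, g <- l (M - i)%N].
exists (flatten [seq [seq glue o p.1 p.2 | o <- [:: true; false], p <- pairs i]
                | i <- iota 0 M.+1]); split.
  apply: (le_trans (size_flatten_map_le (B := 2 * C ^+ 2 * expR (mu'' * M%:R)) _)).
    move=> i; rewrite mem_iota add0n ltnS => iM.
    rewrite !size_allpairs /= natrM -mulrA ler_wpM2l// natrM.
    apply: le_trans (ler_pM _ _ (Hl i).1 (Hl (M - i)%N).1) _ => //.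
    by rewrite mulrACA -expRD -mulrDr -natrD subnKC// expr2.
  rewrite size_iota.
  apply: le_trans (ler_wpM2r _ (natr_le_expR M d0)) _.
    by rewrite mulr_ge0 ?expR_ge0// mulr_ge0// sqr_ge0.
  rewrite mulrACA -expRD -mulrDl subrK -[leRHS]mulrA -expRD -mulrDr -natrD.
  by rewrite /M addnC.
move=> w wm; rewrite evx_glue.
set u := sect _ false w; set v := sect _ true w.
have uv : (wsum (fun x => h + nu x) u.1 + wsum (fun x => h + nu x) v.1 <= M)%N.
  rewrite (leq_trans (wsum_sect _ _ _ nu0 nuD))// leq_add2r (leq_trans _ wm)//.
  rewrite /wsum; elim: (w.1) => //= x s IH; exact: leq_add.
apply/flatten_mapP; exists (wsum (fun x => h + nu x)%N u.1).
  by rewrite mem_iota add0n ltnS (leq_trans _ uv)// leq_addr.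
apply/allpairsP; exists (odd (size w.1), (evx (shift om) u, evx (shift om) v)).
split=> //=; first by rewrite !inE; case: odd.
apply/allpairsP; exists (evx (shift om) u, evx (shift om) v).
split=> //=; first exact: (Hl _).2.
by apply: (Hl _).2; lia.
Qed.

Fixpoint words_upto (n : nat) : seq (seq klein) :=
  if n is n'.+1
  then [::] :: [seq x :: s | x <- enum {: klein}, s <- words_upto n']
  else [:: [::]].

Lemma mem_words_upto n s : (size s <= n)%N -> s \in words_upto n.
Proof.
elim: n s => [|n IH] [|x s] //= sn; rewrite inE /=; apply/allpairsP.
by exists (x, s); rewrite /= mem_enum IH.
Qed.

Lemma size_words_upto n : (0 < size (words_upto n) <= 5 ^ n)%N.
Proof.
elim: n => //= n /andP[IH0 IH].
rewrite size_allpairs -cardT card_prod !card_bool expnS; lia.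
Qed.

(** There are at most 4 * 5^m normal forms with at most m letters, and 5 = 1 + 4 <= exp 4. *)
Lemma tame_base om : tame om (fun=> 1%N) 4.
Proof.
move=> mu' mu4; exists 4 => m.
exists [seq evx om (s, z) | s <- words_upto m, z <- enum {: klein}]; split.
  rewrite size_allpairs -cardT card_prod !card_bool mulnC natrM ler_wpM2l//.
  apply: (@le_trans _ _ ((5 ^ m)%:R)).
    by rewrite ler_nat; case/andP: (size_words_upto m).
  rewrite natrX expRM_natr lerXn2r ?nnegrE ?expR_ge0//.
  by apply: le_trans (expR_ge1Dx _); lra.
move=> [s z] sm; apply/allpairsP; exists (s, z); split=> //.
  apply: mem_words_upto; move: sm; rewrite /wsum /=.
  suff -> : sumn [seq 1 | _ <- s]%N = size s by [].
  by elim: s => //= _ s ->.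
by rewrite mem_enum.
Qed.

Lemma wsum_const k s : wsum (fun=> k) s = (k * size s)%N.
Proof. by rewrite /wsum; elim: s => [|x s] /=; rewrite ?muln0// => ->; lia. Qed.

Lemma tame_const_up om k mu : (0 < k)%N -> 0 <= mu ->
  tame om (fun=> 1%N) (k%:R * mu) -> tame om (fun=> k) mu.
Proof.
move=> k0 mu0 T mu' mumu'.
have kr : 0 < k%:R :> R by rewrite ltr0n.
have [|C HC] := T (k%:R * mu'); first by rewrite ltr_pM2l.
exists C => m; have [l [lC lcov]] := HC (m %/ k)%N; exists l.
have C0 : 0 <= C.
  by have := le_trans (ler0n _ _) lC; rewrite pmulr_lge0// expR_gt0.
split.
  rewrite (le_trans lC)// ler_wpM2l// ler_expR mulrAC -natrM mulrC.
  by rewrite ler_wpM2l ?ler_nat 1?mulnC ?leq_trunc_div// ltW// (le_lt_trans mu0).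
move=> w; rewrite wsum_const => wm; apply: lcov.
by rewrite wsum_const mul1n leq_divRL// mulnC.
Qed.

Lemma tame_const_down om k mu : (0 < k)%N ->
  tame om (fun=> k) mu -> tame om (fun=> 1%N) (k%:R * mu).
Proof.
move=> k0 T mu' mumu'.
have kr : 0 < k%:R :> R by rewrite ltr0n.
have [|C HC] := T (mu' / k%:R); first by rewrite ltr_pdivlMr// mulrC.
exists C => m; have [l [lC lcov]] := HC (k * m)%N; exists l; split.
  by move: lC; rewrite natrM mulrA divfK ?gt_eqF.
by move=> w; rewrite wsum_const mul1n => wm; apply: lcov; rewrite wsum_const leq_mul.
Qed.

Lemma tame_shift om mu : 0 <= mu ->
  tame (shift om) (fun=> 1%N) mu -> tame om (fun=> 1%N) mu.
Proof.
move=> mu0; apply: (@tame_step _ _ 1 (fun=> 0%N)) => //.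
by move=> x; case: phi.
Qed.

Lemma tame_shiftn n om mu : 0 <= mu ->
  tame (shiftn n om) (fun=> 1%N) mu -> tame om (fun=> 1%N) mu.
Proof.
by move=> mu0; elim: n om => //= n IH om /IH; exact: tame_shift.
Qed.

(* With weights [6], [3 + 3 phi 2], [2 + (2 or 4)], [4] per letter at the four
   successive levels, no weight is created along the rules [0, 1, 2]. *)
Lemma tame_contract om mu : 0 <= mu -> om 0%N = 0%N -> om 1%N = 1%N -> om 2 = 2 ->
  tame (shiftn 3 om) (fun=> 1%N) mu -> tame om (fun=> 1%N) (2 / 3 * mu).
Proof.
move=> mu0 om0 om1 om2 T.
have mu6 : 0 <= mu / 6 by rewrite divr_ge0.
have -> : 2 / 3 * mu = 4%:R * (mu / 6) by lra.
apply: tame_const_down => //.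
apply: (@tame_step _ _ 2 (fun x => if x.1 then 2 else 4 * x.2)%N) => //.
- by move=> [[] []] [[] []].
- by move=> [[] []]; rewrite om0.
apply: (@tame_step _ _ 3 (fun x => 3 * phi 2 x)%N) => //.
- by move=> [[] []] [[] []].
- by move=> [[] []]; rewrite [shift om 0]om1.
apply: (@tame_step _ _ 6 (fun=> 0)%N) => //.
- by move=> [[] []]; rewrite [shift _ 0]om2.
apply: tame_const_up => //.
by have -> : 6%:R * (mu / 6) = mu by lra.
Qed.

(** The rules 0, 1, 2 shrink lengths, and the rules 1, 2, 0 make [bicomm] nontrivial. *)
Definition mixing (om : nat -> nat) := forall n, exists m,
  [/\ (n <= m)%N, om m = 0%N, om m.+1 = 1%N, om m.+2 = 2 & om m.+3 = 0%N].

Lemma mixing_shiftn n om : mixing om -> mixing (shiftn n om).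
Proof.
move=> mix p; have [m [pm m0 m1 m2 m3]] := mix (n + p)%N.
exists (m - n)%N; rewrite !shiftnE; have -> : (n + (m - n))%N = m by lia.
have -> : (n + (m - n).+1)%N = m.+1 by lia.
have -> : (n + (m - n).+2)%N = m.+2 by lia.
have -> : (n + (m - n).+3)%N = m.+3 by lia.
by split=> //; lia.
Qed.

(** Each block 0, 1, 2 gains a factor 2/3; the rules before it do not raise the rate, and those
    after it are again mixing. *)
Lemma tame_mixing j om : mixing om -> tame om (fun=> 1%N) ((2 / 3) ^+ j * 4).
Proof.
elim: j om => [|j IH] om mix; first by rewrite expr0 mul1r; exact: tame_base.
have [m [_ m0 m1 m2 m3]] := mix 0%N.
have p0 : 0 <= (2 / 3) ^+ j * 4 :> R by rewrite mulr_ge0// exprn_ge0// divr_ge0.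
rewrite exprS -mulrA; apply: (@tame_shiftn m); first by rewrite mulr_ge0// divr_ge0.
apply: tame_contract => //; rewrite ?shiftnE ?addn0 ?addn1 ?addn2//.
exact/IH/(@mixing_shiftn 3)/mixing_shiftn.
Qed.

Lemma subexponential_mixing om mu : mixing om -> 0 < mu ->
  exists C : R, forall m, exists l,
    (size l)%:R <= C * expR (mu * m%:R) /\ covers om (fun=> 1%N) m l.
Proof.
move=> mix mu0.
have [j jmu] : exists j, (2 / 3) ^+ j * 4 < mu :> R.
  have bern j : 1 + j%:R / 2 <= (3 / 2) ^+ j :> R.
    elim: j => [|j IH]; first by rewrite mul0r addr0 expr0.
    rewrite exprS; apply: le_trans (ler_wpM2l _ IH); last by lra.
    have : 0 <= j%:R :> R by [].
    by rewrite -addn1 natrD; set x := j%:R; lra.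
  (* By Bernoulli, (3/2)^j >= 1 + j/2, so j > 8/mu makes mu times (3/2)^j exceed 4. *)
  exists (Num.bound (8 / mu)).
  set j := Num.bound _; have : 8 / mu < j%:R by rewrite archi_boundP// divr_ge0// ltW.
  rewrite ltr_pdivrMr// => jmu.
  have -> : 2 / 3 = (3 / 2)^-1 :> R by lra.
  rewrite exprVn mulrC ltr_pdivrMr ?exprn_gt0//; last by lra.
  apply: lt_le_trans (ler_wpM2l (ltW mu0) (bern j)).
  by rewrite mulrDr mulr1 mulrA (mulrC mu j%:R); set x := _ * mu in jmu *; lra.
by have := @tame_mixing j om mix mu jmu.
Qed.

End Upper.

(** * The marked groups *)

Section MarkedWords.
Variable k : nat.
Local Open Scope group_scope.

Lemma word_eval_nil (G : groupType) (S : k.-tuple G) : word_eval S [::] = 1.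
Proof. by rewrite /word_eval big_nil. Qed.

Lemma word_eval_cons (G : groupType) (S : k.-tuple G) x w :
  word_eval S (x :: w) = letter_eval S x * word_eval S w.
Proof. by rewrite /word_eval big_cons. Qed.

Lemma word_eval_cat (G : groupType) (S : k.-tuple G) w w' :
  word_eval S (w ++ w') = word_eval S w * word_eval S w'.
Proof. by rewrite /word_eval big_cat. Qed.

Lemma word_eval_winv (G : groupType) (S : k.-tuple G) w :
  word_eval S (winv w) = (word_eval S w)^-1.
Proof.
elim: w => [|[b i] w IH]; first by rewrite word_eval_nil invg1.
have -> : winv ((b, i) :: w) = rcons (winv w) (~~ b, i).
  by rewrite /winv [map _ _]/= rev_cons.
rewrite word_eval_rcons IH word_eval_cons invgM; congr (_ * _).
by rewrite /letter_eval /=; case: b => //=; rewrite invgK.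
Qed.

Lemma word_eval_eq (G : groupType) (S : k.-tuple G) u v :
  word_eval S u = word_eval S v <-> word_eval S (winv v ++ u) = 1.
Proof.
rewrite word_eval_cat word_eval_winv; split=> [->|e]; first by rewrite mulVg.
by rewrite -[LHS](mulVKg (word_eval S v)) e mulg1.
Qed.

(** An edge of the ball compares a word of length n + 1 with one of length n, which amounts to a
    relation of length 2n + 1. *)
Lemma cayley_ball_iso_words n (X Y : marked_group k) :
  (forall w, size w <= n.*2.+1 ->
    (word_eval (mg_gens X) w = 1 <-> word_eval (mg_gens Y) w = 1)) ->
  cayley_ball_iso n X Y.
Proof.
move=> XY.
have eqXY u v : size u <= n.+1 -> size v <= n ->
    word_eval (mg_gens X) u = word_eval (mg_gens X) v <->
    word_eval (mg_gens Y) u = word_eval (mg_gens Y) v.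
  move=> un vn; rewrite !word_eval_eq; apply: XY.
  by rewrite size_cat size_winv; lia.
pose P g w := size w <= n /\ word_eval (mg_gens X) w = g.
pose f g : Y := match pselect (exists w, P g w) with
  | left e => word_eval (mg_gens Y) (projT1 (cid e)) | right _ => 1 end.
have fE w : size w <= n ->
    f (word_eval (mg_gens X) w) = word_eval (mg_gens Y) w.
  move=> wn; rewrite /f; case: pselect => [e|[]]; last by exists w.
  by have [vn /eqXY] := projT2 (cid e); apply => //; exact: leqW.
exists f; split.
- split.
  + by move=> g [w wn <-]; rewrite fE//; exists w.
  + move=> g h; rewrite !inE => -[u un <-] [v vn <-].
    by rewrite !fE// => /eqXY; apply => //; exact: leqW.
  + by move=> h [w wn <-]; exists (word_eval (mg_gens X) w); [exists w|exact: fE].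
- by have := fE [::]; rewrite !word_eval_nil; exact.
- move=> g h i [u un <-] [v vn <-]; rewrite !fE//.
  have := eqXY (rcons u (false, i)) v; rewrite !word_eval_rcons; apply => //.
  by rewrite size_rcons.
Qed.

Lemma cayley_ball_iso_word_eval n (X Y : marked_group k) w :
  cayley_ball_iso n X Y -> size w <= n ->
  (word_eval (mg_gens X) w = 1 <-> word_eval (mg_gens Y) w = 1).
Proof.
move=> [f [[_ f_inj _] f1 fE]] wn; have fw := cayley_ball_isoP f1 fE.
rewrite -(fw w wn) -f1; split=> [->//|]; apply: f_inj; rewrite inE.
- by exists w.
- exact: cayley_ball1.
Qed.

End MarkedWords.

Definition lgroup (om : nat -> nat) : Set :=
  {f : point -> point | exists w, f = weval om w}.

HB.instance Definition _ om := gen_eqMixin (lgroup om).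
HB.instance Definition _ om := gen_choiceMixin (lgroup om).

Section LGroup.
Variable om : nat -> nat.
Implicit Types g h : lgroup om.

Lemma lgroup_inj g h : sval g =1 sval h -> g = h.
Proof.
case: g h => [f wf] [f' wf'] /= /funext e.
by case: _ / e in wf' *; congr exist; exact: Prop_irrelevance.
Qed.

Lemma lgroup_mul_subproof g h : exists w, sval g \o sval h = weval om w.
Proof.
have [w ew] := svalP g; have [w' ew'] := svalP h; exists (w ++ w').
by apply/funext => y; rewrite weval_cat /= ew ew'.
Qed.

Definition lgroup_mul g h : lgroup om := exist _ _ (lgroup_mul_subproof g h).

Lemma lgroup_one_subproof : exists w, id = weval om w.
Proof. by exists [::]. Qed.

Definition lgroup_one : lgroup om := exist _ _ lgroup_one_subproof.

Definition lword g : word 2 := projT1 (cid (svalP g)).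

Lemma lwordE g : sval g = weval om (lword g).
Proof. exact: projT2 (cid (svalP g)). Qed.

Lemma lgroup_inv_subproof g : exists w, weval om (winv (lword g)) = weval om w.
Proof. by eexists. Qed.

Definition lgroup_inv g : lgroup om := exist _ _ (lgroup_inv_subproof g).

Lemma lgroup_mulA : associative lgroup_mul.
Proof. by move=> g h i; exact: lgroup_inj. Qed.

Lemma lgroup_mul1 : left_id lgroup_one lgroup_mul.
Proof. by move=> g; exact: lgroup_inj. Qed.

Lemma lgroup_mulr1 : right_id lgroup_one lgroup_mul.
Proof. by move=> g; exact: lgroup_inj. Qed.

Lemma lgroup_mulV : left_inverse lgroup_one lgroup_inv lgroup_mul.
Proof.
move=> g; apply: lgroup_inj => y.
by rewrite -[LHS]/(weval om (winv (lword g)) (sval g y)) lwordE wevalK.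
Qed.

Lemma lgroup_mulrV : right_inverse lgroup_one lgroup_inv lgroup_mul.
Proof.
move=> g; apply: lgroup_inj => y.
rewrite -[LHS]/(sval g (weval om (winv (lword g)) y)) lwordE.
by rewrite -{1}[lword g]winvK wevalK.
Qed.

HB.instance Definition _ := isGroup.Build (lgroup om)
  lgroup_mulA lgroup_mul1 lgroup_mulr1 lgroup_mulV lgroup_mulrV.

Lemma lgroup_gen_subproof i : exists w, lgen om i = weval om w.
Proof. by exists [:: (false, i)]. Qed.

Definition lgroup_gen (i : 'I_2) : lgroup om := exist _ _ (lgroup_gen_subproof i).

Definition lgroup_gens : 2.-tuple (lgroup om) := [tuple lgroup_gen i | i < 2].

Lemma sval_word_eval w : sval (word_eval lgroup_gens w) = weval om w.
Proof.
elim: w => [|[b i] w IH]; first by rewrite word_eval_nil.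
rewrite word_eval_cons; apply/funext => y /=.
rewrite IH /letter_eval tnth_mktuple /=; case: b => //.
apply: (can_inj (lgenK om i)); rewrite lgenVK.
have := mulgV (lgroup_gen i) => /(congr1 (fun g => sval g (weval om w y))).
by [].
Qed.

Definition lsmall : small_group :=
  @SmallGroup (lgroup om) (Group.class (lgroup om : groupType)).

Lemma lgroup_generates : @generates lsmall 2 lgroup_gens.
Proof.
move=> g; have [w ew] := svalP g; exists w.
by apply: lgroup_inj => y; rewrite sval_word_eval ew.
Qed.

Definition lmarked : marked_group 2 := MarkedGroup lgroup_generates.

Lemma lmarked_word_eval1 w :
  word_eval (mg_gens lmarked) w = 1%g <-> (forall y, weval om w y = y).
Proof.
rewrite -sval_word_eval; split=> [e y|e]; last exact: lgroup_inj.
by rewrite [word_eval _ _]e.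
Qed.

End LGroup.

(** * Dependence of the marked groups on the rules *)

Lemma uniform_words (T : finType) (P : seq T -> nat -> Prop) m :
  (forall s n n', n <= n' -> P s n -> P s n') -> (forall s, exists n, P s n) ->
  exists n, forall s, size s <= m -> P s n.
Proof.
elim: m P => [|m IH] P Pm Pex.
  by have [n Pn] := Pex [::]; exists n => -[].
have /boolp.choice[f fP] : forall x, exists n, forall s, size s <= m -> P (x :: s) n.
  by move=> x; apply: (IH (fun s => P (x :: s))) => // s n n'; exact: Pm.
have [n0 P0] := Pex [::].
exists (maxn n0 (\max_x f x)) => -[_|x s sm].
  exact: Pm (leq_maxl _ _) P0.
apply: Pm (fP x s sm); rewrite leq_max; apply/orP; right; exact: leq_bigmax.
Qed.

(** Finitely many relations determine the ball, and each depends on finitely many rules. *)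
Lemma lmarked_local n om : exists N, forall om',
  (forall i, i < N -> om' i = om i) -> cayley_ball_iso n (lmarked om) (lmarked om').
Proof.
pose P (w : word 2) N := forall om', (forall i, i < N -> om' i = om i) ->
  (forall y, weval om' w y = y) <-> (forall y, weval om w y = y).
have [|w|N HN] := @uniform_words _ P n.*2.+1.
- move=> w N N' NN' PN om' e; apply: PN => i iN; apply: e.
  exact: leq_trans iN NN'.
- have [N HN] := @acts_trivially_local _ om (to_klein w, k0) (leqnn _).
  have trE om'' : acts_trivially om'' (to_klein w, k0) <-> (forall y, weval om'' w y = y).
    have E y : evx om'' (to_klein w, k0) y = weval om'' w y.
      by rewrite /evx actV0 ev_to_klein.
    by split=> t y; have := t y; rewrite E.
  by exists N => om' /HN; rewrite !trE.
- exists N => om' e; apply: cayley_ball_iso_words => w wn.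
  by rewrite !lmarked_word_eval1; apply: iff_sym; exact: HN.
Qed.

(** The word [lift_word] reads only the common rules before n and reduces the comparison to
    [bicomm], trivial for the rule 0 and nontrivial for 1, 2, 0. Its length 20 * 2^n at most doubles
    when written in t and d. *)
Lemma lmarked_separated n om om' :
  (forall i, i < n -> om i = om' i) -> om n = 0 ->
  om' n = 1 -> om' n.+1 = 2 -> om' n.+2 = 0 ->
  exists2 w, size w <= 40 * 2 ^ n &
    word_eval (mg_gens (lmarked om)) w = 1%g /\
    word_eval (mg_gens (lmarked om')) w <> 1%g.
Proof.
move=> e om0 om1 om2 om3; exists (of_klein false (lift_word om n)).
  by apply: leq_trans (size_of_klein _ _) _; rewrite size_lift_word mulnA.
have wE om'' y : weval om'' (of_klein false (lift_word om n)) y =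
    ev om'' (lift_word om n) y.
  exact/weval_of_even_word/even_word_lift_word.
rewrite !lmarked_word_eval1; split=> [y|h].
  by rewrite wE; move: y; apply/ev_lift_word/ev_bicomm0; rewrite shiftnE addn0.
have {h} : forall y, ev om' (lift_word om n) y = y by move=> y; rewrite -wE.
rewrite (lift_word_ext e) => /ev_lift_word; apply: ev_bicomm1.
- by rewrite shiftnE addn0.
- by rewrite shiftnE addn1.
- by rewrite shiftnE addn2.
Qed.

(** * Intermediate growth *)

Lemma growth_covers om n (l : seq (point -> point)) :
  covers om (fun=> 1) (3 * n) l -> growth (mg_gens (lmarked om)) n <= size l.
Proof.
move=> lcov; rewrite /growth; set B := fset_set _.
pose F (g : lgroup om) : point -> point := sval g.
have Finj : injective F by move=> g h e; apply: lgroup_inj => y; rewrite -/(F g) e.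
rewrite -[X in X <= _](size_map F (enum_fset B)); apply: uniq_leq_size.
  by rewrite (map_inj_uniq Finj); exact: fset_uniq.
move=> _ /mapP[g + ->]; rewrite /B in_fset_set; last exact: finite_cayley_ball.
rewrite inE => -[w wn <-]; rewrite /F sval_word_eval.
have -> : weval om w = evx om (to_klein w, k0).
  by apply/funext => y; rewrite /evx actV0 ev_to_klein.
apply: lcov; rewrite wsum_const mul1n (leq_trans (size_to_klein _))//.
by rewrite leq_mul2l wn.
Qed.

Lemma growth_lift_family om n : om n = 1 -> om n.+1 = 2 -> om n.+2 = 0 ->
  2 ^ (2 ^ n) <= growth (mg_gens (lmarked om)) (42 * 4 ^ n).
Proof.
move=> om1 om2 om3; rewrite -(size_lift_family om) /growth; set B := fset_set _.
have uF := uniq_lift_family om1 om2 om3.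
pose F s : lgroup om := word_eval (lgroup_gens om) (of_klein false s).
rewrite -(size_map F); apply: uniq_leq_size.
  rewrite map_inj_in_uniq ?uF// => s s' sF s'F e.
  apply: (lift_family_ev_inj om1 om2 om3 sF s'F) => y.
  rewrite -!weval_of_even_word ?(even_word_lift_family sF, even_word_lift_family s'F)//.
  by rewrite -!sval_word_eval -/(F s) e.
move=> _ /mapP[s sF ->]; rewrite /B [_ \in _]in_fset_set; last exact: finite_cayley_ball.
rewrite inE; exists (of_klein false s) => //.
rewrite (leq_trans (size_of_klein _ _))// (_ : 42 = 2 * 21)// -mulnA leq_mul2l /=.
by rewrite (leq_trans (lift_family_size sF))// leq_subr.
Qed.

Lemma leq_sqr_exp2 n : 4 <= n -> n ^ 2 <= 2 ^ n.
Proof.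
elim: n => // n IH; rewrite ltnS leq_eqVlt => /orP[/eqP<-//|n4].
have := IH n4; rewrite -!mulnn (expnS 2 n); nia.
Qed.

Section Growth.
Variable R : realType.
Local Open Scope ring_scope.

Lemma horner_nat_le (P : {poly R}) (n : nat) : (0 < n)%N ->
  P.[n%:R] <= (\sum_(i < size P) `|P`_i|) * n%:R ^+ size P.
Proof.
move=> n0; rewrite horner_coef mulr_suml; apply: ler_sum => i _.
apply: le_trans (ler_norm _) _; rewrite normrM normrX normr_nat ler_wpM2l//.
by rewrite ler_weXn2l ?ler1n// ltnW.
Qed.

Lemma not_polynomially_bounded om : mixing om ->
  ~ polynomially_bounded R (growth (mg_gens (lmarked om))).
Proof.
move=> mix [P HP].
pose A := Num.bound (\sum_(i < size P) `|P`_i|).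
pose D := size P.
have PA n : (0 < n)%N -> (growth (mg_gens (lmarked om)) n <= A * n ^ D)%N.
  move=> n0; rewrite -(ler_nat R) (le_trans (HP n))// (le_trans (horner_nat_le _ n0))//.
  rewrite natrM natrX ler_wpM2r ?exprn_ge0//.
  by rewrite ltW// archi_boundP// sumr_ge0.
(* Then A + 2 (m + 4) D < (m + 1)^2 <= 2^(m + 1), while 42 <= 4^3 bounds the radius 42 * 4^(m + 1)
   by 2^(2 (m + 4)). *)
have [m [Dm _ m1 m2 m3]] := mix (A + 2 * D + 6 * D + 4)%N.
have N0 : (0 < 42 * 4 ^ m.+1)%N by rewrite muln_gt0 expn_gt0.
have := leq_trans (growth_lift_family m1 m2 m3) (PA _ N0).
apply/negP; rewrite -ltnNge.
apply: (@leq_ltn_trans (2 ^ A * 2 ^ (2 * (m + 4) * D)))%N.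
  apply: leq_mul; first by rewrite ltnW// ltn_expl.
  rewrite expnM; case: (posnP D) => [->//|D0]; rewrite leq_exp2r// expnM.
  by rewrite (_ : m + 4 = 3 + m.+1)%N ?expnD ?leq_mul2r ?orbT//; lia.
rewrite -expnD ltn_exp2l//.
apply: leq_trans (leq_sqr_exp2 _); last by lia.
rewrite -mulnn; have := leq_mul (leqnn m) Dm; nia.
Qed.

Lemma not_exponentially_bounded_below om : mixing om ->
  ~ exponentially_bounded_below R (growth (mg_gens (lmarked om))).
Proof.
move=> mix [c c1 Hc].
have c0 : 0 < c by lra.
(* Translation from t and d at most triples the length, so the growth is at most C exp(3 mu n),
   against c^n = exp(6 mu n). *)
pose mu := ln c / 6.
have mu0 : 0 < mu by rewrite divr_gt0// ln_gt0.
have [C HC] := subexponential_mixing mix mu0.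
have cE : c = expR (6 * mu) 
  by rewrite (_ : 6 * mu = ln c) ?lnK// /mu; lra.
have C1 n : expR (3 * mu * n%:R) <= C.
  have [l [lC /growth_covers gl]] := HC (3 * n)%N.
  have := le_trans (Hc n) (le_trans _ lC); rewrite ler_nat => /(_ gl).
  rewrite cE -expRM_natr natrM [X in _ * expR X](_ : _ = 3 * mu * n%:R); last by lra.
  rewrite (_ : 6 * mu * n%:R = 3 * mu * n%:R + 3 * mu * n%:R); last by lra.
  by rewrite expRD ler_pM2r// expR_gt0.
have mu3 : 0 < 3 * mu by rewrite mulr_gt0.
have := C1 (Num.bound (C / (3 * mu))); apply/negP; rewrite -ltNge.
apply: lt_le_trans (expR_ge1Dx _).
have C0 : 0 <= C by apply: le_trans (C1 0%N); exact: expR_ge0.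
have : C / (3 * mu) < (Num.bound (C / (3 * mu)))%:R.
  by rewrite archi_boundP// divr_ge0// ltW.
by rewrite ltr_pdivrMr// mulrC => h; rewrite (lt_trans h)// ltrDr.
Qed.

Lemma intermediate_growth_mixing om : mixing om ->
  intermediate_growth R (lmarked om).
Proof.
move=> mix; exists 2%N, (mg_gens (lmarked om)); split.
- exact: mg_generates.
- exact: not_polynomially_bounded.
- exact: not_exponentially_bounded_below.
Qed.

End Growth.

(** * Constant rules and the lamplighter group *)

Section Lamplighter.
Local Open Scope ring_scope.

(* In this coordinate [t] is the translation by 1. *)
Definition int_of_pos (n : nat) : int := if odd n then Negz n./2 else Posz n./2.
Definition pos_of_int (z : int) : nat :=
  match z with Posz k => k.*2 | Negz k => k.*2.+1 end.

Lemma int_of_posK : cancel int_of_pos pos_of_int.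
Proof. by move=> n; rewrite /int_of_pos; case: (boolP (odd n)) => on /=; lia. Qed.

Lemma pos_of_intK : cancel pos_of_int int_of_pos.
Proof.
move=> [] k; rewrite /int_of_pos /= odd_double /=; first by rewrite doubleK.
by rewrite uphalf_double.
Qed.

Definition nonzero (a : 'Z_2) : bool := a != 0.

Lemma nonzeroD a b : nonzero (a + b) = nonzero a (+) nonzero b.
Proof. by case: a b => [[|[|?]] ?] [[|[|?]] ?]. Qed.

Lemma nonzero_inj : injective nonzero.
Proof. by case=> [[|[|?]] ?] [[|[|?]] ?] // _; apply: val_inj. Qed.

(** The second bit reads the lamp at the destination. The first records crossings between -1 and 0,
    where b acts on the decoration; as a coboundary it respects products. *)
Definition lact (l : lamplighter) (y : point) : point :=
  let z := int_of_pos y.1 in let z' := l.2 + z in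
  (pos_of_int z', (y.2.1 (+) ((z < 0) (+) (z' < 0)), y.2.2 (+) nonzero (l.1 z'))).

Lemma lactM l l' y : lact (l * l')%g y = lact l (lact l' y).
Proof.
case: l l' y => f m [f' m'] [n [v1 v2]]; rewrite /lact /= pos_of_intK addrA.
congr (_, (_, _)).
  by case: v1; do 3 case: (_ < 0).
rewrite lamps_addE lamps_shiftE nonzeroD [nonzero _ (+) nonzero _]addbC addbA.
by congr (_ (+) nonzero (f' _) (+) _); lia.
Qed.

Lemma lact1 y : lact 1%g y = y.
Proof.
case: y => n [v1 v2]; rewrite /lact /= add0r int_of_posK addbb addbF.
by rewrite lamps0E addbF.
Qed.

Lemma lact_inj l l' : lact l =1 lact l' -> l = l'.
Proof.
case: l l' => f m [f' m'] e.
have mm' : m = m'.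
  have := e (pos_of_int 0, k0) => /(congr1 fst) /(can_inj pos_of_intK).
  by rewrite /= !addr0.
congr (_, _) => //; apply/fsfunP => i; apply: nonzero_inj.
have := e (pos_of_int (i - m), k0) => /(congr1 (fun y => y.2.2)).
by rewrite /= pos_of_intK -mm' addrC subrK.
Qed.

Definition lamp (i : int) : lamps := [fsfun j in [fset i]%fset => 1].

Lemma lampE i j : lamp i j = (j == i)%:R.
Proof. by rewrite fsfunE inE; case: eqP. Qed.

Definition lamp_gen (i : 'I_2) : lamplighter :=
  if i == ord0 then (lamps0, 1) else (lamp 0, 0).

Definition lamp_gens : 2.-tuple lamplighter := [tuple lamp_gen i | i < 2].

Lemma lact_gen om i y : (forall n, om n = 0%N) -> lact (lamp_gen i) y = lgen om i y.
Proof.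
move=> om0; case: y => n [v1 v2]; rewrite /lact /lamp_gen /lgen.
case: eqP => _ /=.
  rewrite /actV /actA /label om0 /= lamps0E addbF /int_of_pos /kadd /flip.
  case: (boolP (odd n)) => on.
    case: n on => //= n /negbTE on; case: eqP => [->|n0].
      by rewrite /= addbT.
    have -> : uphalf n = n./2.-1.+1 by rewrite uphalf_half; lia.
    have -> : 1 + Negz n./2.-1.+1 = Negz n./2.-1 by rewrite !NegzE; lia.
    by rewrite on /= addbF; congr (_, _); lia.
  by rewrite /= (negbTE on) /= addbF; congr (_, _); lia.
rewrite /actV /label om0 /= add0r addbb addbF int_of_posK lampE.
rewrite /kadd /= /int_of_pos; case: (n =P 0%N) => [->|n0] /=; first by rewrite addbC.
case: (boolP (odd n)) => on; first by rewrite addbF.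
have -> : (Posz n./2 == 0) = false by lia.
by rewrite addbF.
Qed.

Lemma lact_word_eval om w y : (forall n, om n = 0%N) ->
  lact (word_eval lamp_gens w) y = weval om w y.
Proof.
move=> om0; elim: w => [|[b i] w IH]; first by rewrite word_eval_nil lact1.
rewrite word_eval_cons lactM IH /letter_eval tnth_mktuple /=; case: b => /=.
  apply: (can_inj (lgenK om i)); rewrite lgenVK -lact_gen// -lactM mulgV.
  exact: lact1.
exact: lact_gen.
Qed.

Lemma lamp_generates : generates lamp_gens.
Proof.
pose gen g := exists w : word 2, word_eval lamp_gens w = g.
have genM g h : gen g -> gen h -> gen (g * h)%g.
  by move=> [w <-] [w' <-]; exists (w ++ w'); rewrite word_eval_cat.
have genV g : gen g -> gen g^-1%g.
  by move=> [w <-]; exists (winv w); rewrite word_eval_winv.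
have gen1 : gen 1%g by exists [::]; rewrite word_eval_nil.
have gen_gen i : gen (lamp_gen i).
  exists [:: (false, i)].
  by rewrite word_eval_cons word_eval_nil mulg1 /letter_eval tnth_mktuple.
have lE (l l' : lamplighter) : l.1 =1 l'.1 -> l.2 = l'.2 -> l = l'.
  by case: l l' => f m [f' m'] /= /fsfunP -> ->.
have genT m : gen (lamps0, m).
  have genN (n : nat) : gen (lamps0, n%:Z).
    elim: n => [|n IH]; first exact: gen1.
    have -> : (lamps0, n.+1%:Z) = ((lamp_gen ord0 : lamplighter) * (lamps0, n%:Z))%g.
      by apply: lE => [i|] /=; rewrite ?lampsE ?addr0//; lia.
    exact: genM.
  case: m => n; first exact: genN.
  have -> : (lamps0, Negz n) = ((lamps0, n.+1%:Z) : lamplighter)^-1%g.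
    by apply: lE => [i|] /=; rewrite ?lampsE ?oppr0//; lia.
  exact/genV/genN.
have genD i : gen (lamp i, 0).
  have -> : (lamp i, 0) = (((lamps0, i) : lamplighter) * lamp_gen ord_max * (lamps0, - i))%g.
    apply: lE => [j|] /=; last by lia.
    by rewrite !lampsE !lampE add0r addr0 subr_eq0.
  exact: genM (genM _ _ (genT i) (gen_gen _)) (genT _).
(* Induction on the support: adding the lamp at i switches it off, as f i = 1. *)
have genF n f : (#|` finsupp f| <= n)%N -> gen (f, 0).
  elim: n f => [|n IH] f.
    rewrite leqn0 cardfs_eq0 => /eqP f0.
    suff -> : (f, 0) = 1%g :> lamplighter by [].
    by apply: lE => // i /=; rewrite lampsE; apply/eqP; rewrite -memNfinsupp f0 inE.
  have [f0 _|[i fi] fn] := fset_0Vmem (finsupp f).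
    by apply: IH; rewrite f0 cardfs0.
  have fi1 : f i = 1.
    by move: fi; rewrite mem_finsupp => fi; apply: nonzero_inj; rewrite /nonzero fi.
  have -> : (f, 0) = (((lamp i, 0) : lamplighter) * (lamps_add f (lamp i), 0))%g.
    apply: lE => [j|] //=; rewrite !lampsE subr0 addrCA.
    have -> (a : 'Z_2) : a + a = 0 by apply: nonzero_inj; rewrite nonzeroD addbb.
    by rewrite addr0.
  apply: genM => //; apply: IH; rewrite -ltnS (leq_trans _ fn)//.
  rewrite (cardfsD1 i (finsupp f)) fi add1n ltnS.
  apply: fsubset_leq_card; apply/fsubsetP => j.
  rewrite !inE !mem_finsupp lampsE lampE.
  case: (j =P i) => [->|_] /=; last by rewrite addr0.
  by rewrite fi1.
move=> [f m].
have -> : (f, m) = (((f, 0) : lamplighter) * (lamps0, m))%g.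
  by apply: lE => [i|] /=; rewrite ?lampsE ?addr0 ?add0r.
by apply: genM => //; exact: (genF _ _ (leqnn _)).
Qed.

(** Both groups act faithfully on [point], and a word in either pair of generators acts in the same
    way. *)
Lemma lmarked_lamplighter om : (forall n, om n = 0%N) ->
  group_isomorphic (lmarked om) lamplighter.
Proof.
move=> om0.
pose F (g : lmarked om) : lamplighter := word_eval lamp_gens (lword g).
have lactF g y : lact (F g) y = sval g y by rewrite /F (lact_word_eval _ _ om0) -lwordE.
have FM : {morph F : g h / (g * h)%g}.
  by move=> g h; apply: lact_inj => y; rewrite lactM !lactF.
pose Fm : {multiplicative lmarked om -> lamplighter} :=
  HB.pack F (isMultiplicative.Build _ _ F FM).
exists Fm.
exists (fun l => word_eval (lgroup_gens om) (projT1 (cid (lamp_generates l)))) => [g|l].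
  apply: lgroup_inj => y; rewrite sval_word_eval -(lact_word_eval _ _ om0).
  by rewrite (projT2 (cid (lamp_generates _))) lactF.
apply: lact_inj => y; rewrite lactF sval_word_eval -(lact_word_eval _ _ om0).
by rewrite (projT2 (cid (lamp_generates _))).
Qed.

End Lamplighter.

(** * The Cantor set of marked groups *)

Definition ternary_digit : Type := discrete_topology 'I_3.
HB.instance Definition _ := DiscreteTopology.on ternary_digit.
HB.instance Definition _ := isPointed.Build ternary_digit (ord0 : 'I_3).

Definition ternary_cantor_like := @cantor_like_finite_prod (fun=> ternary_digit)
  (fun n => @finite_finset 'I_3 _)
  (fun n => ex_intro (fun xy : 'I_3 * 'I_3 => xy.1 != xy.2) (ord0, ord_max) erefl).

Lemma homeomorphic_trans (T U W : topologicalType) :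
  homeomorphic T U -> homeomorphic U W -> homeomorphic T W.
Proof.
move=> [f [g [fc gc fK gK]]] [f' [g' [fc' gc' fK' gK']]].
exists (f' \o f), (g \o g'); split.
- by move=> x; apply: continuous_comp; [exact: fc|exact: fc'].
- by move=> x; apply: continuous_comp; [exact: gc'|exact: gc].
- exact: can_comp.
- exact: can_comp.
Qed.

(** Brouwer's characterization of the Cantor set gives a continuous closed bijection, whose inverse
    is therefore continuous. *)
Lemma homeomorphic_cantor_ternary (R : realType) : homeomorphic cantor_space ternary_seq.
Proof.
have [f [fc fcl]] := @homeomorphism_cantor_like R _ ternary_cantor_like.
have [g fK gK] : bijective f.
  by rewrite -setTT_bijective; split; [exact: funS|exact: inj|exact: surj].
exists f, g; split; [exact: fc| |exact: fK|exact: gK].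
apply/continuous_closedP => A /fcl.
rewrite (_ : f @` A = g @^-1` A)//; apply/seteqP; split=> x /=.
  by move=> [y Ay <-]; rewrite fK.
by move=> Ag; exists (g x); rewrite ?gK.
Qed.

Lemma no_injection_cantor_nat (F : (nat -> bool) -> nat) : ~ injective F.
Proof.
(* Cantor's diagonal set: n is left out exactly if it belongs to a set coded by n. *)
move=> Finj; pose u n : bool := `[< ~ exists v, F v = n /\ v n >].
have [un|un] := boolP (u (F u)).
  by move/asboolP: (un); apply; exists u.
have /asboolPn/contrapT[v [/Finj vu]] := un.
by rewrite vu (negbTE un).
Qed.

Lemma nbhs_prefix (s : cantor_space) N :
  nbhs s [set s' : cantor_space | forall i, (i < N)%N -> s' i = s i].
Proof.
elim: N => [|N IH]; first by apply: filterS filterT => s' _ i.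
have sN : nbhs s [set s' : cantor_space | s' N = s N].
  have h := @proj_continuous nat (fun=> bool) N s [set s N].
  apply: h; apply: open_nbhs_nbhs; split=> //; exact: discrete_open.
apply: filterS (filterI IH sN) => s' [s's s'N] i; rewrite ltnS leq_eqVlt.
by move=> /orP[/eqP->//|]; exact: s's.
Qed.

Lemma continuous_cantor (T : topologicalType) (h : T -> cantor_space) :
  (forall t i, nbhs t [set t' | h t' i = h t i]) -> continuous h.
Proof.
move=> hi t; apply/cvg_sup => i U [_ [[W oW <-] Wt WU]].
by apply: filterS (hi t i) => t' e; apply: WU; rewrite /= e.
Qed.

(** The blocks are 0, 1, 2 and 0, 0, 0. Both start with 0, so any next block completes the pattern
    1, 2, 0. *)
Definition block_rules (s : nat -> bool) (n : nat) : nat :=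
  if s (n %/ 3) then n %% 3 else 0.

Definition lpoint (s : cantor_space) : marked_space 2 :=
  marked_point (lmarked (block_rules s)).

Lemma lpoint_local n s : exists N, forall s' : cantor_space,
  (forall i, (i < N)%N -> s' i = s i) -> marked_close n (lpoint s) (lpoint s').
Proof.
have [N HN] := lmarked_local n (block_rules s); exists N => s' e.
apply/cayley_ball_iso_marked_point/HN => i iN.
by rewrite /block_rules e// (leq_ltn_trans (leq_div _ _)).
Qed.

(** At the first index j where the sequences differ, the rules agree through position 3j and then
    read 0 against 1, 2, 0. If j <= i, the radius for i covers the separating word. *)
Lemma lpoint_separated s s' i :
  marked_close (40 * 2 ^ (3 * i).+1) (lpoint s) (lpoint s') -> s' i = s i.
Proof.
move=> /cayley_ball_iso_marked_point iso; apply: contrapT => s'i.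
have dif : exists j, s' j != s j by exists i; apply/eqP.
have [j sj jmin] := ex_minnP dif.
have ji : (j <= i)%N by apply: jmin; apply/eqP.
have e j' : (j' < j)%N -> s' j' = s j'.
  by move=> j'j; apply/eqP; apply: contraTT j'j => /jmin; rewrite -leqNgt.
have sep r r' : (forall j', (j' < j)%N -> r j' = r' j') ->
    r j = false -> r' j = true ->
    exists2 w, (size w <= 40 * 2 ^ (3 * i).+1)%N &
      word_eval (mg_gens (lmarked (block_rules r))) w = 1%g /\
      word_eval (mg_gens (lmarked (block_rules r'))) w <> 1%g.
  move=> rr' rj r'j.
  have [|||||w wn ww] := @lmarked_separated (3 * j).+1 (block_rules r) (block_rules r').
  - move=> k; rewrite ltnS leq_eqVlt /block_rules => /orP[/eqP->|kj].
      by rewrite mulKn// mulnC modnMl; do 2 case: ifP.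
    by rewrite rr'// ltn_divLR// mulnC.
  - by rewrite /block_rules (_ : (3 * j).+1 %/ 3 = j)%N ?rj//; lia.
  - by rewrite /block_rules (_ : (3 * j).+1 %/ 3 = j)%N ?r'j; lia.
  - by rewrite /block_rules (_ : (3 * j).+2 %/ 3 = j)%N ?r'j; lia.
  - by rewrite /block_rules (_ : (3 * j).+3 %% 3 = 0)%N ?if_same//; lia.
  exists w => //; apply: leq_trans wn _.
  by rewrite leq_mul2l leq_exp2l// ltnS leq_mul2l ji.
case sjE : (s j) sj => sj.
- have s'j : s' j = false by case: (s' j) sj.
  have [w wn [w1 w2]] := sep _ _ e s'j sjE.
  by apply: w2; apply/(cayley_ball_iso_word_eval iso wn).
- have s'j : s' j = true by case: (s' j) sj.
  have [w wn [w1 w2]] := sep _ _ (fun k kj => esym (e k kj)) sjE s'j.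
  by apply: w2; apply/(cayley_ball_iso_word_eval iso wn).
Qed.

Lemma lpoint_inj : injective lpoint.
Proof.
move=> s s' e; apply/funext => i; apply: (@lpoint_separated s' s i).
by rewrite e; exact: cayley_ball_iso_refl.
Qed.

Lemma lpoint_continuous : continuous lpoint.
Proof.
move=> s U [n nU]; have [N HN] := lpoint_local n s.
by apply: filterS (nbhs_prefix s N) => s' /HN /nU.
Qed.

Lemma lpoint_condensation s : perfect_kernel (lpoint s).
Proof.
move=> U oU Us /countable_injP[F Finj].
have [n nU] : nbhs (lpoint s) U by exact: open_nbhs_nbhs.
have [N HN] := lpoint_local n s.
(* The sequences that agree with s before N form a copy of the Cantor set, mapped injectively into
   U. *)
pose splice (u : nat -> bool) : cantor_space :=
  fun j => if (j < N)%N then s j else u (j - N)%N.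
have splice_inj : injective splice.
  move=> u v e; apply/funext => j; have := congr1 (fun r => r (N + j)%N) e.
  by rewrite /splice ltnNge leq_addr /= addKn.
have Usplice u : U (lpoint (splice u)).
  by apply/nU/HN => i iN; rewrite /splice iN.
apply: (@no_injection_cantor_nat (fun u => F (lpoint (splice u)))) => u v e.
by apply/splice_inj/lpoint_inj/(Finj _ _ _ _ e); rewrite inE.
Qed.

Lemma homeomorphic_range_lpoint (A : set (marked_space 2)) :
  A = range lpoint -> homeomorphic (set_type A) cantor_space.
Proof.
move=> AE.
have Ap (p : set_type A) : exists s, lpoint s = set_val p.
  have [s _ sp] : range lpoint (set_val p) by rewrite -AE; exact: set_mem (valP p).
  by exists s.
have /boolp.choice[f fE] := Ap.
have As s : A (lpoint s) by rewrite AE; exists s.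
pose g s : set_type A := SigSub (mem_set (As s)).
exists f, g; split.
- apply: continuous_cantor => p i.
  (* Points this close have the same i-th coordinate, whence the continuity of the inverse. *)
  pose M := (40 * 2 ^ (3 * i).+1)%N.
  have near_p : nbhs p
      (set_val @^-1` [set q | marked_close M (set_val p) q] : set (set_type A)).
    by apply: (@initial_continuous _ _ set_val p); exists M.
  by apply: filterS near_p => q /=; rewrite -!fE; exact: lpoint_separated.
- by apply: continuous_comp_initial => s; exact: lpoint_continuous.
- by move=> p; apply: val_inj => /=; exact: fE.
- by move=> s; apply: lpoint_inj; rewrite fE.
Qed.

(** * From ternary sequences to rules *)

Definition jumps (w : ternary_seq) : cantor_space := fun n => w n != w n.+1.

Lemma jumps_surj s : exists w, jumps w = s.
Proof.
(* Starting from 0, the value toggles between 0 and 2 at every prescribed jump. *)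
pose w := fix w n : 'I_3 :=
  if n is m.+1 then
    if s m then (if w m == ord0 then ord_max else ord0) else w m
  else ord0.
exists w; apply/funext => n; rewrite /jumps /=.
case: (s n); last by rewrite eqxx.
by case: (w n =P ord0) => [->|/eqP ->].
Qed.

Lemma constant_jumps (w : ternary_seq) :
  constant_seq w -> forall n, block_rules (jumps w) n = 0.
Proof. by move=> [a wa] n; rewrite /block_rules /jumps !wa eqxx. Qed.

Lemma mixing_jumps (w : ternary_seq) :
  ~ eventually_constant w -> mixing (block_rules (jumps w)).
Proof.
move=> wN n.
have [m nm jm] : exists2 m, (n <= m)%N & jumps w m.
  apply: contrapT => h; apply: wN; exists (w n), n; elim=> [|m IH].
    by rewrite leqn0 => /eqP->.
  rewrite leq_eqVlt => /orP[/eqP->//|]; rewrite ltnS => nm.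
  rewrite -(IH nm); apply/esym/eqP/negPn/negP => jm.
  by apply: h; exists m.
exists (3 * m)%N; rewrite /block_rules; split.
- by lia.
- by rewrite (_ : 3 * m %% 3 = 0)%N ?if_same//; lia.
- by rewrite (_ : (3 * m).+1 %/ 3 = m)%N ?jm; lia.
- by rewrite (_ : (3 * m).+2 %/ 3 = m)%N ?jm; lia.
- by rewrite (_ : (3 * m).+3 %% 3 = 0)%N ?if_same//; lia.
Qed.

Theorem mainTheorem1 (R : realType) :
  exists L : ternary_seq -> marked_group 2,
    let LL : set (marked_space 2) :=
      [set marked_point (L w) | w in [set: ternary_seq]] in
    [/\ homeomorphic (set_type LL) ternary_seq /\
          homeomorphic (set_type LL) cantor_space,
        forall w : ternary_seq, ~ eventually_constant w ->
          intermediate_growth R (L w),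
        forall w : ternary_seq, constant_seq w ->
          group_isomorphic (L w) lamplighter &
        forall w : ternary_seq, condensation_group (L w)].
Proof.
exists (fun w => lmarked (block_rules (jumps w))) => LL.
(* The family factors through [jumps], which is onto, so its range is that of the injective map
   [lpoint]. *)
have LLE : LL = range lpoint.
  apply/seteqP; split=> p [].
    by move=> w _ <-; exists (jumps w).
  by move=> s _ <-; have [w <-] := jumps_surj s; exists w.
have LLc := homeomorphic_range_lpoint LLE.
split=> [|w wN|w wc|w].
- by split=> //; exact: homeomorphic_trans LLc (homeomorphic_cantor_ternary R).
- exact/intermediate_growth_mixing/mixing_jumps.
- exact/lmarked_lamplighter/constant_jumps.
- exists 2%N, (lgroup_gens _), (@lgroup_generates (block_rules (jumps w))); split=> //.
  exact: lpoint_condensation.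
Qed.
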